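(* Let $G$ be a finite simple connected graph with $c(G)\ge 1$ and $c(G)+q(G)\ge 3$, and let $\lambda\neq 1$ be a real number. Suppose that $$G-\Gamma(G)=\mathcal{C}_G\cup\mathcal{T}_G\cup\mathcal{P}_G,$$ where $\mathcal{C}_G$ is the disjoint union of graphs $C(g_m,h_m)$ ($1\le m\le c(G)$), $\mathcal{T}_G$ is the disjoint union of graphs $T(k_i,l_i)$ ($1\le i\le q(G)$), and $\mathcal{P}_G$ is the disjoint union of paths $P_{t_j}$ ($1\le j\le|\Gamma(G)|-1$), attached to $\Gamma(G)$ in the way described in the context. Then $G$ is $\lambda$-optimal, i.e. $m_G(\lambda)=2c(G)+q(G)-1$, if and only if $$m_{Q_{g_m,h_m}}(\lambda)=2\ \ (1\le m\le c(G)),\qquad m_{B_{k_i,l_i}}(\lambda)=1\ \ (1\le i\le q(G)),\qquad m_{U_{t_j}}(\lambda)=1\ \ (1\le j\le|\Gamma(G)|-1).$$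
   Context: All graphs are finite and simple. For a graph $G$, $L(G)=D(G)-A(G)$ is the Laplacian matrix, and $m_G(\lambda)$ is the multiplicity of $\lambda$ as an eigenvalue of $L(G)$; for a square matrix $M$, $m_M(\lambda)$ is the multiplicity of $\lambda$ as an eigenvalue of $M$ ($0$ if $\lambda$ is not an eigenvalue, or if $M$ has order $0$). A pendant vertex is a vertex of degree $1$; a quasi-pendant vertex is a vertex adjacent to a pendant vertex; $q(G)$ is the number of quasi-pendant vertices. For connected $G$, $c(G)=|E(G)|-|V(G)|+1$. $G$ is $\lambda$-optimal if $m_G(\lambda)=2c(G)+q(G)-1$. $T(k,l)$ ($k,l\ge 1$): the tree on $k+l$ vertices obtained from the star $K_{1,k}$ by identifying its center with one end vertex of the path $P_l$; the other end vertex of $P_l$ is the $l$-vertex of $T(k,l)$ (if $l=1$, $T(k,1)=K_{1,k}$ and the $1$-vertex is the center). $C(g,l)$ ($g\ge 3$, $l\ge 1$): the graph on $g+l-1$ vertices obtained from the cycle $C_g$ by identifying one of its vertices with one end vertex of $P_l$; the other end vertex of $P_l$ is the $l$-vertex of $C(g,l)$ (if $l=1$, $C(g,1)=C_g$ and the $1$-vertex is the chosen vertex of the cycle). $B_{k,l}$ is the matrix of order $k+l$ obtained from $L(T(k,l+1))$ by deleting the row and column of the $(l+1)$-vertex. $Q_{g,l}$ is the matrix of order $g+l-1$ obtained from $L(C(g,l+1))$ by deleting the row and column of the $(l+1)$-vertex. $U_n$ is the matrix of order $n$ obtained from $L(P_{n+2})$ by deleting the rows and columns of both end vertices of $P_{n+2}$.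 $\Gamma(G)$ is the set of vertices of $G$ of degree at least $3$ that neither lie on a cycle of $G$ nor are quasi-pendant. Standing assumption on the decomposition of $G-\Gamma(G)$ (all cycles and stars are pendant structures): the $C(g_m,h_m)$, with $h_m\ge1$, contain the cycles of $G$, and each is joined to the rest of $G$ by exactly one edge, from its $h_m$-vertex to a vertex of $\Gamma(G)$; the $T(k_i,l_i)$, with $l_i\ge 1$, contain the quasi-pendant vertices of $G$ (with all their pendant neighbours), and each is joined to the rest of $G$ by exactly one edge, from its $l_i$-vertex to a vertex of $\Gamma(G)$; the $P_{t_j}$ are the internal paths joining pairs of distinct vertices of $\Gamma(G)$ (all vertices of $P_{t_j}$ have degree $2$ in $G$, and the two ends of the path are adjacent to the two respective vertices of $\Gamma(G)$), where $t_j=0$ corresponds to two adjacent vertices of $\Gamma(G)$. *)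

(* Defs.v *)
From mathcomp Require Import all_boot all_order all_fingroup all_algebra.
From mathcomp Require Import reals.

Set Implicit Arguments.
Unset Strict Implicit.
Unset Printing Implicit Defensive.

Import GRing.Theory.
Local Open Scope ring_scope.

(* A simple graph on [T] is a symmetric irreflexive relation [e : rel T];
   symmetry and irreflexivity are hypotheses of the theorem. *)

Section Graph.
Variables (T : finType) (e : rel T).

Definition connected_graph : Prop :=
  (0 < #|T|)%N /\ forall x y : T, connect e x y.

Definition deg (x : T) : nat := #|[set y | e x y]|.

Definition edges : {set {set T}} :=
  [set A : {set T} | [exists x, exists y, e x y && (A == [set x; y])]].

(* For a connected graph |T| <= |E| + 1, so the subtraction is not truncated. *)
Definition cyclomatic : nat := (#|edges| + 1 - #|T|)%N.

Definition quasi_pendant (x : T) : bool :=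
  [exists y, e x y && (deg y == 1)%N].

Definition nb_quasi_pendant : nat := #|[set x | quasi_pendant x]|.

Definition graph_cycle (s : seq T) : bool := (2 < size s)%N && ucycleb e s.

(* The bound on the length loses nothing: a cycle has at most |T| vertices. *)
Definition on_cycle (x : T) : bool :=
  [exists n : 'I_#|T|.+1, exists s : n.-tuple T, graph_cycle s && (x \in s)].

Definition Gamma : {set T} :=
  [set x | [&& (2 < deg x)%N, ~~ on_cycle x & ~~ quasi_pendant x]].

End Graph.

Section Laplacian.
Variables (R : realType) (T : finType).

Definition degree_mx (e : rel T) : 'M[R]_#|T| :=
  diag_mx (\row_i (deg e (enum_val i))%:R).

Definition adjacency_mx (e : rel T) : 'M[R]_#|T| :=
  \matrix_(i, j) (e (enum_val i) (enum_val j))%:R.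

Definition laplacian (e : rel T) : 'M[R]_#|T| := degree_mx e - adjacency_mx e.

(* Deletion of the rows and columns indexed by the vertices in [S]. *)
Definition delete_mx (S : {set T}) (M : 'M[R]_#|T|) : 'M[R]_#|~: S| :=
  mxsub (fun i => enum_rank (enum_val i)) (fun j => enum_rank (enum_val j)) M.

End Laplacian.

(* Algebraic multiplicity; it is 0 for a matrix of order 0, whose
   characteristic polynomial is 1. *)
Definition mult (R : realType) (n : nat) (M : 'M[R]_n) (lam : R) : nat :=
  mup lam (char_poly M).

Definition lambda_optimal (R : realType) (T : finType) (e : rel T) (lam : R) :
  Prop :=
  mult (laplacian R e) lam = (2 * cyclomatic e + nb_quasi_pendant e - 1)%N.

Definition path_graph (n : nat) : rel 'I_n :=
  fun x y => (y == x.+1 :> nat) || (x == y.+1 :> nat).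

(* T(k,l): the pendant vertices are 0, ..., k-1 and the path P_l is
   k, ..., k+l-1; the centre of the star is k and the l-vertex is k+l-1. *)
Definition tree_arc (k : nat) (x y : nat) : bool :=
  if (x < k)%N then y == k else y == x.+1.

Definition tree_graph (k l : nat) : rel 'I_(k + l) :=
  fun x y => tree_arc k x y || tree_arc k y x.

(* C(g,l): the cycle is 0, ..., g-1 and the path P_l is g-1, ..., g+l-2; the
   l-vertex is g+l-2. *)
Definition cycle_arc (g : nat) (x y : nat) : bool :=
  (y == x.+1) || (x == 0)%N && (y == g.-1).

Definition cycle_graph (g l : nat) : rel 'I_(g + l - 1) :=
  fun x y => cycle_arc g x y || cycle_arc g y x.

Definition is_first (n : nat) (x : 'I_n) : bool := (x == 0 :> nat)%N.
(* In T(k,l) and C(g,l) the last vertex is the l-vertex. *)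
Definition is_last (n : nat) (x : 'I_n) : bool := (x.+1 == n :> nat)%N.

Section SpecialMatrices.
Variable R : realType.

Definition Bmx (k l : nat) :=
  delete_mx [set x | is_last x] (laplacian R (@tree_graph k l.+1)).

Definition Qmx (g l : nat) :=
  delete_mx [set x | is_last x] (laplacian R (@cycle_graph g l.+1)).

Definition Umx (n : nat) :=
  delete_mx [set x | is_first x || is_last x]
            (laplacian R (@path_graph n.+2)).

End SpecialMatrices.

Section Decomposition.
Variables (T : finType) (e : rel T).

Definition induced_copy (n : nat) (a : rel 'I_n) (f : 'I_n -> T) : Prop :=
  injective f /\ forall x y, e (f x) (f y) = a x y.

Definition vset (n : nat) (f : 'I_n -> T) : {set T} := [set f x | x : 'I_n].

(* Exactly one edge leaves the copy; it goes from the last vertex to a vertex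
   of Gamma. *)
Definition pendant_attached (n : nat) (f : 'I_n -> T) : Prop :=
  exists2 v, v \in Gamma e &
    forall (x : 'I_n) (y : T),
      y \notin vset f -> e (f x) y = is_last x && (y == v).

(* The internal path [f] joins [a] and [b]; the path with no vertex is the edge
   between [a] and [b]. *)
Definition joins (n : nat) (f : 'I_n -> T) (a b : T) : Prop :=
  [/\ a \in Gamma e, b \in Gamma e, a != b & n = 0%N -> e a b] /\
  forall x : 'I_n,
    [/\ deg e (f x) = 2%N, is_first x -> e (f x) a & is_last x -> e (f x) b].

Definition component (c q p : nat) (sc : 'I_c -> nat) (st : 'I_q -> nat)
    (sp : 'I_p -> nat) (fc : forall m, 'I_(sc m) -> T)
    (ft : forall i, 'I_(st i) -> T) (fp : forall j, 'I_(sp j) -> T)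
    (s : 'I_c + 'I_q + 'I_p) : {set T} :=
  match s with
  | inl (inl m) => vset (fc m)
  | inl (inr i) => vset (ft i)
  | inr j => vset (fp j)
  end.

Record decomposition
    (g h : 'I_(cyclomatic e) -> nat) (k l : 'I_(nb_quasi_pendant e) -> nat)
    (t : 'I_(#|Gamma e| - 1) -> nat) := Decomposition {
  cyc : forall m, 'I_(g m + h m - 1) -> T;
  tre : forall i, 'I_(k i + l i) -> T;
  pth : forall j, 'I_(t j) -> T;
  end1 : 'I_(#|Gamma e| - 1) -> T;
  end2 : 'I_(#|Gamma e| - 1) -> T;
  comps := component cyc tre pth;
  g_ge3 : forall m, (3 <= g m)%N;
  h_ge1 : forall m, (1 <= h m)%N;
  k_ge1 : forall i, (1 <= k i)%N;
  l_ge1 : forall i, (1 <= l i)%N;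
  cyc_copy : forall m, induced_copy (@cycle_graph (g m) (h m)) (@cyc m);
  tre_copy : forall i, induced_copy (@tree_graph (k i) (l i)) (@tre i);
  pth_copy : forall j, induced_copy (@path_graph (t j)) (@pth j);
  comps_cover : \bigcup_s comps s = ~: Gamma e;
  comps_disjoint : forall s s', s != s' -> [disjoint comps s & comps s'];
  comps_separated : forall s s' x y,
    s != s' -> x \in comps s -> y \in comps s' -> ~~ e x y;
  cyc_cycles : forall s : seq T,
    graph_cycle e s -> exists m, {subset s <= vset (@cyc m)};
  cyc_attached : forall m, pendant_attached (@cyc m);
  tre_quasi_pendant : forall x, quasi_pendant e x ->
    exists2 i, x \in vset (@tre i) &
      forall y, e x y -> deg e y = 1%N -> y \in vset (@tre i);
  tre_attached : forall i, pendant_attached (@tre i);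
  pth_joins : forall j, joins (@pth j) (end1 j) (end2 j);
  (* the empty paths correspond bijectively to the edges inside Gamma(G) *)
  pth_empty : forall x y, x \in Gamma e -> y \in Gamma e -> e x y ->
    exists! j, t j = 0%N /\ [set end1 j; end2 j] = [set x; y]
}.

End Decomposition.

(* Main.v *)
(** Let [x] range over functions on the vertices and write [W] for the kernel of
    the compression of [L - lam] to [G - Gamma].  It splits over the pieces of
    [G - Gamma], where three-term recurrences bound the multiplicities by 2 for
    a [C(g,h)], by 1 for a [T(k,l)] (as [lam <> 1]) and by 1 for a path.  With
    [N = |Gamma|] and [delta] the total deficiency from these bounds,
    [dim W = 2c + q + N - 1 - delta].  Let [K] be the space of functions [al] on
    [Gamma] orthogonal to [(L - lam) W].  By rank-nullity and self-adjointness,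
      [dim W - N <= m_G(lam) <= dim W - N + 2 dim K].
    So it is enough that [delta >= 2 dim K + 1] as soon as [K <> 0].  Let [X] be
    the set of vertices where some [al] in [K] is not zero.  A pendant piece at a
    vertex of [X] is deficient, and a non-deficient path has both or none of its ends
    in [X], the value of [al] at one end determining the value at the other.
    The [N - 1] internal paths make [Gamma] a tree, so that [dim K] is at most
    the number of vertices of [X] not joined to their parent by a non-deficient
    path; counting the at least [3 |X|] edges at [X] gives the bound. *)

From HB Require Import structures.
Require Import Defs.
From mathcomp Require Import all_boot all_order all_fingroup all_algebra.
From mathcomp Require Import reals zify ring lra.

Set Implicit Arguments.
Unset Strict Implicit.
Unset Printing Implicit Defensive.

Import Order.TTheory GRing.Theory Num.Theory.
Local Open Scope ring_scope.

(** * Eigenvalue multiplicities as kernel dimensions *)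

(** This is similarity through [P], whose determinant is cancelled. The two orders are only
    propositionally equal because [A] will be a block matrix of order rank of kernel plus rank of
    image. *)
Lemma char_poly_intertwine (F : fieldType) (m n : nat) (P : 'M[F]_(m, n))
    (A : 'M_m) (B : 'M_n) :
  m = n -> row_free P -> P *m B = A *m P -> char_poly A = char_poly B.
Proof.
move=> Emn; move: Emn P A => -> P A; rewrite row_free_unit => Pu PB.
have dP : \det (map_mx polyC P) != 0 by rewrite det_map_mx polyC_eq0 -unitfE -unitmxE.
apply: (mulIf dP); rewrite /char_poly -det_mulmx mulrC -det_mulmx; congr (\det _).
rewrite /char_poly_mx mulmxBl mulmxBr -!map_mxM PB.
by rewrite mul_scalar_mx mul_mx_scalar.
Qed.

Lemma char_poly_scalar (F : fieldType) (n : nat) (a : F) :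
  char_poly (a%:M : 'M_n) = ('X - a%:P) ^+ n.
Proof.
by rewrite /char_poly /char_poly_mx map_scalar_mx -raddfB /= det_scalar.
Qed.

(** With [N = M - a], the space is the direct sum of the kernel and the row space of [N]. On the
    kernel [M] acts as [a]; on the row space it acts as a matrix [A] without eigenvalue [a], since
    an eigenvector would lie in both summands. *)
Lemma mup_char_poly_semisimple (F : fieldType) (n : nat) (M : 'M[F]_n) (a : F) :
  (kermx (M - a%:M) :&: (M - a%:M) = 0)%MS ->
  mup a (char_poly M) = \rank (kermx (M - a%:M)).
Proof.
set N := M - a%:M => kerI.
have MN : M = N + a%:M by rewrite /N subrK.
set K := row_base (kermx N); set I := row_base N.
have KN : K *m N = 0.
  by apply/sub_kermxP; rewrite /K eq_row_base.
pose A := I *m M *m pinvmx I.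
have IM : I *m M = A *m I.
  rewrite /A mulmxKpV // MN mulmxDr mul_mx_scalar addmx_sub //.
    by rewrite /I eq_row_base submxMl.
  by rewrite scalemx_sub.
pose P := col_mx K I.
have rP : \rank P = (\rank (kermx N) + \rank N)%N.
  rewrite -addsmxE; have := mxrank_sum_cap K I.
  suff -> : (K :&: I)%MS = 0 by rewrite mxrank0 addn0 /K /I !eq_row_base.
  by apply/eqP; rewrite -submx0 -kerI; apply: capmxS; rewrite eq_row_base.
have sz : (\rank (kermx N) + \rank N = n)%N.
  by rewrite mxrank_ker subnK // rank_leq_row.
have PM : P *m M = block_mx a%:M 0 0 A *m P.
  rewrite /P mul_col_mx mul_block_col !mul0mx addr0 add0r -IM; congr col_mx.
  by rewrite {1}MN mulmxDr KN add0r mul_mx_scalar mul_scalar_mx.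
have := char_poly_intertwine sz _ PM; rewrite /row_free rP eqxx => /(_ isT) <-.
rewrite /char_poly char_block_diag_mx det_lblock -!/(char_poly _).
rewrite char_poly_scalar mupMl ?mup_XsubCX ?eqxx //.
rewrite -eigenvalue_root_char; apply/eigenvalueP => -[v vA].
apply/negP; rewrite negbK.
have vI0 : v *m I *m N = 0.
  rewrite /N mulmxBr -mulmxA IM mulmxA vA mul_mx_scalar -scalemxAl.
  by rewrite subrr.
have : (v *m I <= kermx N :&: N)%MS.
  rewrite sub_capmx; apply/andP; split; first exact/sub_kermxP.
  by rewrite (submx_trans (submxMl _ _)) // /I eq_row_base.
rewrite kerI submx0 => /eqP vI.
by apply/eqP; apply: (row_free_inj (row_base_free N)); rewrite vI mul0mx.
Qed.

(** If [v] is in the kernel of the symmetric [N] and [v = w *m N], then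
    [v *m v^T = v *m N *m w^T = 0], and a sum of squares vanishes only termwise. *)
Lemma mup_char_poly_sym (F : realFieldType) (n : nat) (M : 'M[F]_n) (a : F) :
  M^T = M -> mup a (char_poly M) = \rank (kermx (M - a%:M)).
Proof.
move=> Msym; apply: mup_char_poly_semisimple; set N := M - a%:M.
have Nsym : N^T = N by rewrite /N linearB /= tr_scalar_mx Msym.
apply/eqP/rowV0P => v; rewrite sub_capmx => /andP[/sub_kermxP vN /submxP[w vE]].
have : v *m v^T = 0.
  by rewrite {2}vE trmx_mul Nsym mulmxA vN mul0mx.
move/matrixP/(_ 0 0); rewrite !mxE => /eqP; rewrite psumr_eq0 => [/allP v0|i _].
  apply/rowP => i; have := v0 i (mem_index_enum _).
  by rewrite !mxE mulf_eq0 orbb => /eqP.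
by rewrite !mxE -expr2 sqr_ge0.
Qed.

(** * Functions on the vertices: supports and orthogonality *)

Section FunctionSpace.
Variables (R : realFieldType) (T : finType).
Local Notation V := {ffun T -> R^o}.
Implicit Types (x y z : V) (A B : {set T}) (U W C : {vspace V}).

Lemma dim_ffun_regular : \dim {: V} = #|T|.
Proof. by rewrite dimvf /dim /= muln1. Qed.

Definition restr A (x : V) : V := [ffun v => if v \in A then x v else 0].

Fact restr_is_linear A : linear (restr A).
Proof.
move=> a x y; apply/ffunP => v; rewrite !ffunE.
by case: ifP => // _; rewrite scaler0 addr0.
Qed.
HB.instance Definition _ A := GRing.isLinear.Build R V V _ (restr A) (restr_is_linear A).

Definition fsupp A : {vspace V} := lker (linfun (restr (~: A))).

Lemma fsuppP A x : reflect (forall v, v \notin A -> x v = 0) (x \in fsupp A).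
Proof.
rewrite memv_ker lfunE /=; apply: (iffP eqP) => [/ffunP x0 v vA | x0].
  by have := x0 v; rewrite !ffunE inE vA.
by apply/ffunP => v; rewrite !ffunE inE; case: ifP => // /x0.
Qed.

Lemma restr_fsupp A x : restr A x \in fsupp A.
Proof. by apply/fsuppP => v /negbTE vA; rewrite ffunE vA. Qed.

(** Evaluation at the points of [A] is injective on [U]. Used below to bound the kernels of the
    pieces and the space [coker]. *)
Lemma dimv_determined U A :
  (forall x, x \in U -> (forall v, v \in A -> x v = 0) -> x = 0) ->
  (\dim U <= #|A|)%N.
Proof.
move=> Udet.
pose f x : 'rV[R]_#|A| := \row_i x (enum_val i).
have f_lin : linear f by move=> a x y; apply/rowP => i; rewrite !mxE !ffunE.
pose fl := GRing.isLinear.Build R V 'rV[R]_#|A| _ f f_lin.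
pose g : {linear V -> 'rV[R]_#|A|} := HB.pack f fl.
have gE x : linfun g x = f x by rewrite lfunE.
rewrite -(limg_dim_eq (f := linfun g)).
  by apply: (leq_trans (dimvS (subvf _))); rewrite dimvf dim_matrix mul1r.
apply/eqP; rewrite -subv0; apply/subvP => x; rewrite memv_cap memv_ker gE.
case/andP => xU /eqP/rowP fx0; rewrite memv0; apply/eqP/Udet => // v vA.
by have := fx0 (enum_rank_in vA v); rewrite !mxE enum_rankK_in.
Qed.

Lemma dim_fsupp A : \dim (fsupp A) = #|A|.
Proof.
have le_dim B : (\dim (fsupp B) <= #|B|)%N.
  apply: dimv_determined => x /fsuppP x0 xB; apply/ffunP => v; rewrite ffunE.
  by have [/xB|/x0] := boolP (v \in B).
apply/eqP; rewrite eqn_leq le_dim /=.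
(* The supports in [A] and in its complement span everything, so their two upper bounds, which add
   up to [#|T|], are both attained. *)
have : (\dim {: V} <= \dim (fsupp A) + \dim (fsupp (~: A)))%N.
  apply: leq_trans (dimv_add_leqif _ _); apply: dimvS; apply/subvP => x _.
  have -> : x = restr A x + restr (~: A) x.
    by apply/ffunP => v; rewrite !ffunE inE; case: ifP; rewrite ?addr0 ?add0r.
  by apply: memv_add; apply: restr_fsupp.
have := le_dim (~: A); have := cardsC A; rewrite dim_ffun_regular.
lia.
Qed.

Definition dot x y : R := \sum_v x v * y v.

Lemma dot_linearl y a x x' : dot (a *: x + x') y = a * dot x y + dot x' y.
Proof.
rewrite /dot mulr_sumr -big_split; apply: eq_bigr => v _.
by rewrite !ffunE mulrDl mulrA.
Qed.

Lemma dot_restrl A x y : (forall v, v \notin A -> y v = 0) -> dot (restr A x) y = dot x y.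
Proof.
move=> y0; apply: eq_bigr => v _; rewrite ffunE; case: ifPn => // /y0 ->.
by rewrite !mulr0.
Qed.

(** Pairing with a basis of [C] presents the orthogonal of [C] as the kernel of a map into a space
    of dimension [\dim C], so that rank-nullity applies. *)
Definition basis_dots C x : 'rV[R]_(\dim C) := \row_i dot x (vbasis C)`_i.

Fact basis_dots_is_linear C : linear (basis_dots C).
Proof. by move=> a x y; apply/rowP => i; rewrite !mxE dot_linearl. Qed.
HB.instance Definition _ C :=
  GRing.isLinear.Build R V 'rV[R]_(\dim C) _ (basis_dots C) (basis_dots_is_linear C).

Definition orth C : {vspace V} := lker (linfun (basis_dots C)).

Lemma orthP C x : reflect (forall y, y \in C -> dot x y = 0) (x \in orth C).
Proof.
rewrite memv_ker lfunE /=; apply: (iffP eqP) => [/rowP x0 y yC | x0].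
  rewrite (coord_vbasis yC) /dot.
  under eq_bigr do rewrite sum_ffunE mulr_sumr.
  rewrite exchange_big big1 //= => i _.
  transitivity (coord (vbasis C) i y * dot x (vbasis C)`_i).
    by rewrite mulr_sumr; apply: eq_bigr => v _; rewrite !ffunE mulrCA.
  by have := x0 i; rewrite !mxE => ->; rewrite mulr0.
apply/rowP => i; rewrite !mxE; apply/x0/vbasis_mem/mem_nth.
by rewrite size_tuple.
Qed.

Lemma leq_dim_orth C U : (\dim U <= \dim C + \dim (U :&: orth C))%N.
Proof.
rewrite -(limg_ker_dim (linfun (basis_dots C)) U) addnC leq_add2r.
by apply: (leq_trans (dimvS (subvf _))); rewrite dimvf dim_matrix mul1r.
Qed.

(** * Compressions of a self-adjoint operator *)

Section SelfAdjoint.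
Variable D : 'End(V).
Hypothesis D_adj : forall x y, dot (D x) y = dot x (D y).

(* The kernel of the compression of [D] to [A], i.e. of the principal submatrix
   indexed by [A]. *)
Definition kerc A : {vspace V} := (fsupp A :&: D @^-1: fsupp (~: A))%VS.

Lemma kercP A x :
  reflect ((forall v, v \notin A -> x v = 0) /\ (forall v, v \in A -> D x v = 0))
          (x \in kerc A).
Proof.
rewrite memv_cap -memv_preim.
apply: (iffP andP) => -[/fsuppP x0 h]; split => //.
- by move: h => /fsuppP h v vA; apply: h; rewrite inE negbK.
- by apply/fsuppP => v; rewrite inE negbK; apply: h.
Qed.

Lemma kercT : kerc setT = lker D.
Proof.
apply/vspaceP => x; rewrite memv_ker; apply/kercP/eqP => [[_ x0]|x0].
  by apply/ffunP => v; rewrite x0 ?inE // ffunE.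
by split=> v; rewrite ?inE // x0 ffunE.
Qed.

(** [D] sends the kernel of the compression to [~: A] into the functions supported on [A], and what
    it kills lies in [lker D]. *)
Lemma dim_kercC_leq A : (\dim (kerc (~: A)) <= \dim (kerc setT) + #|A|)%N.
Proof.
rewrite -(limg_ker_dim D (kerc (~: A))) -dim_fsupp; apply: leq_add.
  by rewrite kercT; apply/dimvS/capvSr.
apply/dimvS/subvP => _ /memv_imgP[x /kercP[_ x0] ->].
by apply/fsuppP => v vA; apply: x0; rewrite inE.
Qed.

(* [fsupp A :&: orth (D @: kerc (~: A))] is the cokernel of the coupling map
   from the kernel outside [A] to the functions on [A]. *)
Definition coker A : {vspace V} := (fsupp A :&: orth (D @: kerc (~: A)))%VS.

Lemma cokerP A x :
  reflect ((forall v, v \notin A -> x v = 0) /\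
           (forall y, y \in kerc (~: A) -> dot x (D y) = 0))
          (x \in coker A).
Proof.
rewrite memv_cap; apply: (iffP andP) => -[/fsuppP x0 h]; split => //.
- by move=> y yK; move/orthP: h; apply; apply: memv_img.
- by apply/orthP => _ /memv_imgP[y yK ->]; apply: h.
Qed.

(** Restrict [lker D] to [A]. The functions killed by this lie in [kerc (~: A)], and by
    self-adjointness the restrictions lie in [coker A]. A second [\dim (coker A)] comes from
    comparing [#|A|] with the dimension of the image of [kerc (~: A)] under [D]. *)
Lemma dim_kerc_leqC A :
  (\dim (kerc setT) + #|A| <= \dim (kerc (~: A)) + (\dim (coker A)).*2)%N.
Proof.
have := leq_dim_orth (D @: kerc (~: A)) (fsupp A); rewrite dim_fsupp -/(coker A).
have := limg_ker_dim D (kerc (~: A)).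
have := limg_ker_dim (linfun (restr A)) (kerc setT).
have : (\dim (kerc setT :&: lker (linfun (restr A))) <=
        \dim (kerc (~: A) :&: lker D))%N.
  apply/dimvS/subvP => x; rewrite -{1}[A]setCK kercT memv_cap => /andP[xD].
  move=> /fsuppP xA; rewrite memv_cap xD andbT; apply/kercP; split=> // v _.
  by move: xD; rewrite memv_ker => /eqP ->; rewrite ffunE.
have : (\dim (linfun (restr A) @: kerc setT) <= \dim (coker A))%N.
  apply/dimvS/subvP => z /memv_imgP[x]; rewrite kercT memv_ker => /eqP Dx0 -> {z}.
  rewrite lfunE /=; apply/cokerP; split; first exact/fsuppP/restr_fsupp.
  move=> y /kercP[y0 Dy0]; rewrite dot_restrl => [|v vA].
    by rewrite -D_adj Dx0 /dot big1 // => v _; rewrite ffunE mul0r.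
  by apply: Dy0; rewrite inE.
(* Here [a + b] is rank-nullity for the restriction to [A] on [kerc setT], [c + d] is rank-nullity
   for [D] on [kerc (~: A)], and [k] is the dimension of [coker A]. *)
have arith a b c d k N : (b <= k -> a <= c -> N <= d + k -> a + b + N <= c + d + k.*2)%N.
  by lia.
by move=> hb ha <- <- hN; apply: arith.
Qed.

(** A function in the kernel over the union is the sum of its restrictions to the [B i]. Since [D]
    does not couple distinct pieces, each restriction is in the kernel of its own piece. *)
Lemma dim_kerc_bigcup (I : finType) (B : I -> {set T}) :
  (forall i j, i != j -> [disjoint B i & B j]) ->
  (forall i j x v, i != j -> x \in fsupp (B i) -> v \in B j -> D x v = 0) ->
  (\dim (kerc (\bigcup_i B i)) = \sum_i \dim (kerc (B i)))%N.
Proof.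
move=> disj sep.
have notin i j v : i != j -> v \in B i -> v \notin B j.
  by move=> /disj dij vi; rewrite (disjointFr dij vi).
have -> : kerc (\bigcup_i B i) = (\sum_i kerc (B i))%VS.
  apply/eqP; rewrite eqEsubv; apply/andP; split; apply/subvP => x.
    move=> /kercP[x0 Dx0].
    have xE : x = \sum_i restr (B i) x.
      apply/ffunP => v; rewrite sum_ffunE.
      have [/bigcupP[i _ vi]|vN] := boolP (v \in \bigcup_i B i).
        rewrite (bigD1 i) //= big1 ?addr0 => [|j ji]; rewrite ffunE ?vi //.
        by rewrite (negbTE (notin _ _ _ _ vi)) // eq_sym.
      rewrite x0 // big1 // => i _; rewrite ffunE; case: ifP => // vi.
      by case/bigcupP: vN; exists i.
    rewrite xE; apply: memv_sumr => i _; apply/kercP; split.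
      exact/fsuppP/restr_fsupp.
    move=> v vi; have vU : v \in \bigcup_i B i by apply/bigcupP; exists i.
    have := Dx0 v vU; rewrite {1}xE linear_sum sum_ffunE.
    rewrite (bigD1 i) //= big1 ?addr0 // => j ji.
    exact: sep ji (restr_fsupp _ _) vi.
  apply: (subvP _ x) => {x}; apply/subv_sumP => i _; apply/subvP => x.
  move=> /kercP[x0 Dx0]; apply/kercP; split=> [v vN|v].
    by apply: x0; apply: contra vN => vi; apply/bigcupP; exists i.
  case/bigcupP => j _ vj; have [ij|ij] := eqVneq i j; first by apply: Dx0; rewrite ij.
  by apply: sep ij _ vj; apply/fsuppP.
have : directv (\sum_i kerc (B i)).
  apply/directv_sum_independent => x xK sx0 i _; apply/ffunP => v.
  rewrite ffunE; have xi j := kercP _ _ (xK j isT).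
  have [vi|vi] := boolP (v \in B i); last by case: (xi i) => ->.
  move/ffunP/(_ v): sx0; rewrite sum_ffunE ffunE (bigD1 i) //= big1 ?addr0 //.
  by move=> j ji; case: (xi j) => -> //; apply: notin vi; rewrite eq_sym.
by move/directvP.
Qed.

End SelfAdjoint.

End FunctionSpace.

(** * The operator [L - lam] *)

Section LaplacianOperator.
Variables (R : realType) (T : finType) (e : rel T).
Hypothesis e_sym : symmetric e.
Variable lam : R.
Local Notation V := {ffun T -> R^o}.
Implicit Types (x y : V) (v w : T).

Definition lap_shift x : V :=
  [ffun v => \sum_w (e v w)%:R * (x v - x w) - lam * x v].

Fact lap_shift_is_linear : linear lap_shift.
Proof.
move=> a x y; apply/ffunP => v; rewrite !ffunE /GRing.scale /= mulrBr mulr_sumr.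
rewrite addrACA -big_split -opprD mulrDr [a * (lam * _)]mulrCA; congr (_ - _).
by apply: eq_bigr => w _ /=; rewrite !ffunE /GRing.scale /=; ring.
Qed.
HB.instance Definition _ :=
  GRing.isLinear.Build R V V _ lap_shift lap_shift_is_linear.

Definition lapD : 'End(V) := linfun lap_shift.

Lemma lapDE x v : lapD x v = \sum_w (e v w)%:R * (x v - x w) - lam * x v.
Proof. by rewrite lfunE ffunE. Qed.

Lemma lapD_deg x v :
  lapD x v = ((deg e v)%:R - lam) * x v - \sum_w (e v w)%:R * x w.
Proof.
rewrite lapDE; under eq_bigr do rewrite mulrBr.
rewrite big_split /= sumrN -mulr_suml mulrBl addrAC; congr (_ * _ - _ - _).
rewrite /deg cardsE -sum1_card natr_sum [RHS]big_mkcond /=; apply: eq_bigr => w _.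
by rewrite unfold_in; case: (e v w).
Qed.

Lemma lapD_adj x y : dot (lapD x) y = dot x (lapD y).
Proof.
rewrite /dot; under eq_bigr do rewrite lapD_deg mulrBl mulr_suml.
under [RHS]eq_bigr do rewrite lapD_deg mulrBr mulr_sumr.
rewrite !big_split !sumrN /=; congr (_ - _).
  by apply: eq_bigr => v _; ring.
rewrite exchange_big; apply: eq_bigr => v _; apply: eq_bigr => w _ /=.
by rewrite e_sym; ring.
Qed.

(** The diagonal of [M] carries degrees in the whole graph [e], so [M] is a principal submatrix of
    the Laplacian. Extension by zero along [phi] identifies the kernel of [M - lam] with that of the
    compression. *)
Lemma mult_dim_kerc n (M : 'M[R]_n) (phi : 'I_n -> T) :
  injective phi ->
  (forall i j, M i j = (deg e (phi i))%:R *+ (i == j) - (e (phi i) (phi j))%:R) ->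
  mult M lam = \dim (kerc lapD [set phi i | i : 'I_n]).
Proof.
move=> phi_inj ME; have Msym : M^T = M.
  by apply/matrixP => i j; rewrite mxE !ME e_sym eq_sym; case: eqP => // ->.
rewrite /mult mup_char_poly_sym //; set N := M - _; set B := row_base (kermx N).
pose ext (u : 'rV[R]_n) : V := [ffun v => \sum_i u 0 i *+ (phi i == v)].
have ext_phi u i : ext u (phi i) = u 0 i.
  rewrite ffunE (bigD1 i) //= eqxx big1 ?addr0 // => j ji.
  by rewrite (inj_eq phi_inj) (negbTE ji).
have ext0 u v : v \notin [set phi i | i : 'I_n] -> ext u v = 0.
  move=> vN; rewrite ffunE big1 // => i _; case: eqP => // iv.
  by case/imsetP: vN; exists i.
have Dext u j : lapD (ext u) (phi j) = (u *m N) 0 j.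
  rewrite lapD_deg ext_phi !mxE.
  transitivity (((deg e (phi j))%:R - lam) * u 0 j -
                \sum_i u 0 i * (e (phi i) (phi j))%:R).
    congr (_ - _); under eq_bigr do rewrite ffunE mulr_sumr.
    rewrite exchange_big; apply: eq_bigr => i _ /=.
    rewrite (bigD1 (phi i)) //= eqxx big1 ?addr0 => [|w wi].
      by rewrite mulr1n e_sym mulrC.
    by rewrite eq_sym (negbTE wi) mulr0.
  under [RHS]eq_bigr do rewrite !mxE ME -addrA [- _ - _]addrC addrA mulrBr.
  rewrite sumrB; congr (_ - _).
  rewrite (bigD1 j) //= eqxx big1 ?addr0 => [|i /negbTE ->].
    by rewrite mulr1n mulrC.
  by rewrite subrr mulr0.
have g_lin : linear (fun w : 'rV_(\rank (kermx N)) => ext (w *m B)).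
  move=> a x y; apply/ffunP => v; rewrite !ffunE /GRing.scale /= mulr_sumr.
  rewrite -big_split; apply: eq_bigr => i _ /=.
  by rewrite mulmxDl -scalemxAl !mxE mulrnDl mulrnAr.
pose g : {linear 'rV[R]_(\rank (kermx N)) -> V} :=
  HB.pack (fun w : 'rV_(\rank (kermx N)) => ext (w *m B))
          (GRing.isLinear.Build R _ _ _ _ g_lin).
have gE (w : 'rV[R]_(\rank (kermx N))) : linfun g w = ext (w *m B) by rewrite lfunE.
have -> : kerc lapD [set phi i | i : 'I_n] = limg (linfun g).
  apply/vspaceP => x; apply/kercP/memv_imgP => [[x0 Dx0]|[w _ ->]]; last first.
    rewrite gE; split => [|v /imsetP[i _ ->]]; first exact: ext0.
    rewrite Dext; have /sub_kermxP -> : (w *m B <= kermx N)%MS.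
      by rewrite (submx_trans (submxMl _ _)) // eq_row_base.
    by rewrite mxE.
  pose u := \row_i x (phi i) : 'rV[R]_n.
  have xE : x = ext u.
    apply/ffunP => v; have [/imsetP[i _ ->]|vN] := boolP (v \in [set phi i | i : 'I_n]).
      by rewrite ext_phi mxE.
    by rewrite x0 // ext0.
  have : (u <= B)%MS.
    rewrite eq_row_base; apply/sub_kermxP/rowP => i.
    by rewrite -Dext -xE Dx0 ?mxE // imset_f.
  by case/submxP => w uE; exists w; rewrite ?memvf // gE -uE.
rewrite limg_dim_eq ?dimvf ?dim_matrix ?mul1r //.
apply/eqP; rewrite -subv0; apply/subvP => w; rewrite memv_cap memv_ker gE memvf /=.
move=> /eqP ew0; rewrite memv0; apply/eqP.
apply: (row_free_inj (row_base_free (kermx N))); rewrite mul0mx.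
by apply/rowP => i; rewrite -ext_phi ew0 !ffunE !mxE.
Qed.

Lemma mult_laplacian : mult (laplacian R e) lam = \dim (kerc lapD setT).
Proof.
rewrite (@mult_dim_kerc _ _ enum_val) //; first last.
- by move=> i j; rewrite !mxE.
- exact: enum_val_inj.
congr (\dim (kerc _ _)); apply/setP => v; rewrite inE; apply/imsetP.
by exists (enum_rank v); rewrite ?enum_rankK.
Qed.

End LaplacianOperator.

(** * Three-term recurrences *)

Section LinearRecurrence.
Variables (R : nzRingType) (y : nat -> R) (c : R) (m n : nat).
Hypothesis y_rec : forall i, (m <= i)%N -> (i.+2 <= n)%N -> y i + y i.+2 = c * y i.+1.

Lemma recurrence_zero_up :
  y m = 0 -> y m.+1 = 0 -> forall i, (m <= i <= n)%N -> y i = 0.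
Proof.
move=> y0 y1; suff y01 d : (m + d.+1 <= n)%N -> y (m + d)%N = 0 /\ y (m + d.+1)%N = 0.
  move=> i /andP[mi lin]; have [->//|im] := eqVneq i m.
  have [|_] := y01 (i - m.+1)%N; first by lia.
  by congr (y _ = _); lia.
elim: d => [|d IH] dn; first by rewrite addn0 addn1.
have [|yd yd1] := IH; first by lia.
split=> //; have := y_rec (leq_addr d m); rewrite -!addnS yd1 yd mulr0 add0r.
by apply.
Qed.

Lemma recurrence_zero_down :
  y n = 0 -> y n.-1 = 0 -> forall i, (m <= i <= n)%N -> y i = 0.
Proof.
move=> y0 y1; suff y01 d : (m + d.+1 <= n)%N -> y (n - d)%N = 0 /\ y (n - d.+1)%N = 0.
  move=> i /andP[mi lin]; have [->//|ni] := eqVneq i n.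
  have [|_] := y01 (n - i.+1)%N; first by lia.
  by congr (y _ = _); lia.
elim: d => [|d IH] dn; first by rewrite subn0 subn1.
have [|yd yd1] := IH; first by lia.
split=> //; have := @y_rec (n - d.+2)%N.
have -> : ((n - d.+2).+1 = n - d.+1)%N by lia.
have -> : ((n - d.+1).+1 = n - d)%N by lia.
by rewrite yd1 yd mulr0 addr0; apply; lia.
Qed.

End LinearRecurrence.

(** * Model graphs embedded in [e] *)

Section Pieces.
Variables (T : finType) (e : rel T).

(* [psi] embeds the graph [b] on [0, N) in such a way that every neighbour of
   the image of an [inner] vertex is in the image. *)
Definition realizes (N : nat) (inner : pred nat) (b : rel nat) (psi : nat -> T) :=
  (forall i j, (i < N)%N -> (j < N)%N -> psi i = psi j -> i = j) /\
  (forall i z, (i < N)%N -> inner i ->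
     e (psi i) z = [exists j : 'I_N, b i j && (z == psi j)]).

Definition inner_set (N : nat) (inner : pred nat) (psi : nat -> T) : {set T} :=
  [set psi i | i : 'I_N & inner i].

Variables (N : nat) (inner : pred nat) (b : rel nat) (psi : nat -> T).
Hypothesis psi_real : realizes N inner b psi.

Lemma mem_inner_set i : (i < N)%N -> (psi i \in inner_set N inner psi) = inner i.
Proof.
move=> iN; apply/imsetP/idP => [[j]|ii]; last by exists (Ordinal iN); rewrite ?inE.
by rewrite inE => ij /(proj1 psi_real i j iN (ltn_ord j)) ->.
Qed.

Lemma realizes_adj i j : (i < N)%N -> (j < N)%N -> inner i -> e (psi i) (psi j) = b i j.
Proof.
move=> iN jN ii; rewrite (proj2 psi_real) //; apply/existsP/idP => [[k]|bij].
  by case/andP => bik /eqP/(proj1 psi_real j k jN (ltn_ord k)) ->.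
by exists (Ordinal jN); rewrite bij eqxx.
Qed.

Lemma realizes_deg i : (i < N)%N -> inner i ->
  deg e (psi i) = #|[set j : 'I_N | b i j]|.
Proof.
move=> iN ii; rewrite -(@card_in_imset _ _ (fun j : 'I_N => psi j)); last first.
  by move=> j k _ _ /(proj1 psi_real) jk; apply/val_inj/jk.
congr #|pred_of_set _|; apply/setP => z; rewrite inE (proj2 psi_real) //.
apply/existsP/imsetP => [[j /andP[bij /eqP ->]]|[j]]; first by exists j; rewrite ?inE.
by rewrite inE => bij ->; exists j; rewrite bij eqxx.
Qed.

Lemma realizes_nbr2 i p q : (i < N)%N -> inner i -> (p < N)%N -> (q < N)%N ->
  (forall j, (j < N)%N -> b i j = (j == p) || (j == q)) ->
  forall z, e (psi i) z = (z == psi p) || (z == psi q).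
Proof.
move=> iN ii pN qN bE z; rewrite (proj2 psi_real) //.
apply/existsP/orP => [[j]|]; first by rewrite bE // => /andP[/orP[] /eqP ->]; auto.
by case=> /eqP->; [exists (Ordinal pN)|exists (Ordinal qN)]; rewrite bE //= !eqxx ?orbT.
Qed.

Section Kernel.
Variables (R : realType) (lam : R).
Hypothesis e_sym : symmetric e.
Local Notation A := (inner_set N inner psi).
Local Notation K := (kerc (lapD e lam) A).

(** All neighbours of an inner vertex are in the image of [psi], so its degree in the model equals
    its degree in [e]. The model's reduced Laplacian is thus a principal submatrix of the Laplacian
    of [e]; this covers [Bmx], [Qmx] and [Umx]. *)
Lemma mult_delete_mx (a : rel 'I_N) (S : {set 'I_N}) :
  (forall i j, a i j = b i j) -> S = [set i : 'I_N | ~~ inner i] ->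
  mult (delete_mx S (laplacian R a)) lam = \dim K.
Proof.
move=> ab SE; have inS (u : 'I_N) : (u \in ~: S) = inner u by rewrite SE !inE negbK.
rewrite (mult_dim_kerc e_sym lam (phi := fun i : 'I_#|~: S| => psi (enum_val i : 'I_N))).
- congr (\dim (kerc _ _)); apply/setP => z.
  apply/imsetP/imsetP => [[i _ ->]|[i]].
    by exists (enum_val i) => //; rewrite inE -inS enum_valP.
  rewrite inE -inS => iS ->.
  by exists (enum_rank_in iS i); rewrite ?enum_rankK_in.
- move=> i j /(proj1 psi_real) ij; apply/enum_val_inj/val_inj/ij => //.
- move=> i j; have innerP (u : 'I_#|~: S|) : inner (enum_val u) by rewrite -inS enum_valP.
  rewrite !mxE !enum_rankK (inj_eq enum_rank_inj) (inj_eq enum_val_inj).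
  rewrite realizes_adj // realizes_deg // ab; congr (_%:R *+ _ - _).
  by rewrite /deg; apply: eq_card => u; rewrite !inE ab.
Qed.

Lemma kerc_outside x i : x \in K -> (i < N)%N -> ~~ inner i -> x (psi i) = 0.
Proof. by case/kercP => x0 _ iN ii; apply: x0; rewrite mem_inner_set. Qed.

Lemma kerc_eq0 x : x \in K -> (forall i, (i < N)%N -> x (psi i) = 0) -> x = 0.
Proof.
case/kercP => x0 _ xi; apply/ffunP => v; rewrite ffunE.
by have [/imsetP[i _ ->]|/x0] := boolP (v \in A); first exact: xi.
Qed.

Lemma kerc_deg2 x i p q : x \in K -> (i < N)%N -> inner i ->
  (p < N)%N -> (q < N)%N -> p != q ->
  (forall j, (j < N)%N -> b i j = (j == p) || (j == q)) ->
  x (psi p) + x (psi q) = (2 - lam) * x (psi i).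
Proof.
move=> /kercP[_ Dx] iN ii pN qN pq bE.
have := Dx (psi i); rewrite mem_inner_set // => /(_ ii); rewrite lapDE.
have psi_pq : psi q != psi p.
  by apply: contraNneq pq => /(proj1 psi_real) -> //.
rewrite (bigD1 (psi p)) // (bigD1 (psi q)) //= big1 => [|w /andP[wp wq]]; last first.
  by rewrite (realizes_nbr2 _ _ pN qN bE) // (negbTE wp) (negbTE wq) mul0r.
rewrite !(realizes_nbr2 _ _ pN qN bE) // !eqxx orbT !mul1r.
lra.
Qed.

Lemma kerc_deg1 x i p : x \in K -> (i < N)%N -> inner i -> (p < N)%N ->
  (forall j, (j < N)%N -> b i j = (j == p)) ->
  x (psi p) = (1 - lam) * x (psi i).
Proof.
move=> /kercP[_ Dx] iN ii pN bE.
have := Dx (psi i); rewrite mem_inner_set // => /(_ ii); rewrite lapDE.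
have bE' j : (j < N)%N -> b i j = (j == p) || (j == p) by rewrite orbb; apply: bE.
rewrite (bigD1 (psi p)) //= big1 => [|w wp]; last first.
  by rewrite (realizes_nbr2 _ _ pN pN bE') // (negbTE wp) mul0r.
rewrite (realizes_nbr2 _ _ pN pN bE') // !eqxx mul1r.
lra.
Qed.

End Kernel.
End Pieces.

(** * Kernels of the internal paths, of T(k,l) and of C(g,l) *)

Section SpecialPieces.
Variables (R : realType) (T : finType) (e : rel T) (lam : R) (psi : nat -> T).
Hypothesis e_sym : symmetric e.
Local Notation kernel N inner := (kerc (lapD e lam) (inner_set N inner psi)).

(** Positions [0] and [t.+1] stand for the two hubs joined by the path, so the kernel functions
    vanish there. *)
Definition path_inner (t : nat) : pred nat := fun i => (0 < i < t.+1)%N.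
Definition path_adj : rel nat := fun i j => (j == i.+1) || (i == j.+1).
Definition tree_adj (k : nat) : rel nat := fun i j => tree_arc k i j || tree_arc k j i.
Definition cycle_adj (g : nat) : rel nat := fun i j => cycle_arc g i j || cycle_arc g j i.

Section Path.
Variable t : nat.
Hypothesis psi_real : realizes e t.+2 (path_inner t) path_adj psi.

Lemma path_kernel_rec x : x \in kernel t.+2 (path_inner t) ->
  forall i, (0 <= i)%N -> (i.+2 <= t.+1)%N ->
    x (psi i) + x (psi i.+2) = (2 - lam) * x (psi i.+1).
Proof.
move=> xK i _ it; apply: (kerc_deg2 psi_real xK) => //; rewrite /path_inner /path_adj; try lia.
Qed.

Lemma path_kernel_ends x : x \in kernel t.+2 (path_inner t) ->
  x (psi 0) = 0 /\ x (psi t.+1) = 0.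
Proof. by move=> xK; split; apply: (kerc_outside psi_real xK); rewrite // /path_inner; lia. Qed.

Lemma path_kernel_first x : x \in kernel t.+2 (path_inner t) ->
  x (psi 1) = 0 -> x = 0.
Proof.
move=> xK x1; have [x0 _] := path_kernel_ends xK.
apply: (kerc_eq0 xK) => i it.
by apply: (recurrence_zero_up (y := x \o psi) (path_kernel_rec xK)); rewrite //=; lia.
Qed.

Lemma path_kernel_last x : x \in kernel t.+2 (path_inner t) ->
  x (psi t) = 0 -> x = 0.
Proof.
move=> xK x1; have [_ x0] := path_kernel_ends xK.
apply: (kerc_eq0 xK) => i it.
by apply: (recurrence_zero_down (y := x \o psi) (path_kernel_rec xK)); rewrite //=; lia.
Qed.

Lemma dim_path_kernel : (\dim (kernel t.+2 (path_inner t)) <= 1)%N.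
Proof.
rewrite -[leqRHS](cards1 (psi 1)); apply: dimv_determined => x xK /(_ _ (set11 _)).
exact: path_kernel_first.
Qed.

Lemma mult_Umx : mult (Umx R t) lam = \dim (kernel t.+2 (path_inner t)).
Proof.
apply: (mult_delete_mx psi_real) => //.
by apply/setP => i; have := ltn_ord i; rewrite !inE /path_inner /is_first /is_last; lia.
Qed.

End Path.

Section Tree.
Variables (k l : nat).
Local Notation inner := (fun i : nat => (i < k + l)%N).
Hypothesis psi_real : realizes e (k + l.+1) inner (tree_adj k) psi.

Lemma mult_Bmx : mult (Bmx R k l) lam = \dim (kernel (k + l.+1) inner).
Proof.
apply: (mult_delete_mx psi_real) => //.
by apply/setP => i; have := ltn_ord i; rewrite !inE /is_last; lia.
Qed.

Hypothesis l_gt0 : (0 < l)%N.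
Hypothesis lam_neq1 : lam <> 1.

(** The function vanishes at the hub, position [k + l]. A further zero at the [l]-vertex propagates
    down the path to the centre [k], and from there to the pendant vertices. *)
Lemma tree_kernel_last x : x \in kernel (k + l.+1) inner ->
  x (psi (k + l).-1) = 0 -> x = 0.
Proof.
move=> xK xu; have xv : x (psi (k + l)) = 0 by apply: (kerc_outside psi_real xK) => //=; lia.
have xpath i : (k <= i <= k + l)%N -> x (psi i) = 0.
  apply: (recurrence_zero_down (y := x \o psi) (c := 2 - lam)) => //= {}i ki il.
  apply: (kerc_deg2 psi_real xK) => //; try lia.
  by move=> j jt; rewrite /tree_adj /tree_arc; do 2 case: ifP; lia.
apply: (kerc_eq0 xK) => i it; have [ki|ik] := leqP k i; first by apply: xpath; lia.
(* The equation at a pendant vertex; a zero at the centre forces a zero here because [lam <> 1]. *)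
have /eqP : x (psi k) = (1 - lam) * x (psi i).
  apply: (kerc_deg1 psi_real xK it); try lia.
  by move=> j jt; rewrite /tree_adj /tree_arc; do 2 case: ifP; lia.
rewrite xpath; last by lia.
rewrite eq_sym mulf_eq0 => /orP[|/eqP //]; by rewrite subr_eq0 eq_sym => /eqP.
Qed.

Lemma dim_tree_kernel : (\dim (kernel (k + l.+1) inner) <= 1)%N.
Proof.
rewrite -[leqRHS](cards1 (psi (k + l).-1)); apply: dimv_determined => x xK /(_ _ (set11 _)).
exact: tree_kernel_last.
Qed.

End Tree.

Section Cycle.
Variables (g h : nat).
Local Notation inner := (fun i : nat => (i < g + h - 1)%N).
Hypothesis psi_real : realizes e (g + h.+1 - 1) inner (cycle_adj g) psi.

Lemma mult_Qmx : mult (Qmx R g h) lam = \dim (kernel (g + h.+1 - 1) inner).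
Proof.
apply: (mult_delete_mx psi_real) => //.
by apply/setP => i; have := ltn_ord i; rewrite !inE /is_last; lia.
Qed.

Hypothesis g_ge3 : (3 <= g)%N.
Hypothesis h_gt0 : (0 < h)%N.

(** Zeros at the hub and at the [h]-vertex propagate down the path to the cycle vertex [g.-1]. If
    moreover [x] vanishes at [0], the equation at [0], whose neighbours are [1] and [g.-1], gives a
    zero at [1], and the recurrence runs along the cycle through its vertices of degree 2. *)
Lemma cycle_kernel_last x : x \in kernel (g + h.+1 - 1) inner ->
  x (psi (g + h - 1).-1) = 0 -> x (psi 0) = 0 -> x = 0.
Proof.
move=> xK xu x0.
have xv : x (psi (g + h - 1)) = 0 by apply: (kerc_outside psi_real xK) => //=; lia.
have xpath i : (g.-1 <= i <= g + h - 1)%N -> x (psi i) = 0.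
  apply: (recurrence_zero_down (y := x \o psi) (c := 2 - lam)) => //= {}i ki il.
  apply: (kerc_deg2 psi_real xK) => //; try lia.
  by move=> j jt; rewrite /cycle_adj /cycle_arc; lia.
have x1 : x (psi 1) = 0.
  have := kerc_deg2 psi_real xK (i := 0) (p := 1) (q := g.-1).
  rewrite x0 (xpath g.-1); last by lia.
  rewrite addr0 mulr0; apply; try lia.
  by move=> j jt; rewrite /cycle_adj /cycle_arc; lia.
have xcycle i : (0 <= i <= g.-1)%N -> x (psi i) = 0.
  apply: (recurrence_zero_up (y := x \o psi) (c := 2 - lam)) => //= {}i ki il.
  apply: (kerc_deg2 psi_real xK) => //; try lia.
  by move=> j jt; rewrite /cycle_adj /cycle_arc; lia.
apply: (kerc_eq0 xK) => i it.
by have [ki|ik] := leqP g.-1 i; [apply: xpath; lia | apply: xcycle; lia].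
Qed.

Lemma dim_cycle_kernel : (\dim (kernel (g + h.+1 - 1) inner) <= 2)%N.
Proof.
have : (#|[set psi (g + h - 1).-1; psi 0%N]| <= 2)%N by rewrite cards2; case: eqP.
apply: leq_trans; apply: dimv_determined => x xK x0.
by apply: cycle_kernel_last => //; apply: x0; rewrite !inE eqxx ?orbT.
Qed.

Lemma dim_cycle_kernel_last :
  (forall x, x \in kernel (g + h.+1 - 1) inner -> x (psi (g + h - 1).-1) = 0) ->
  (\dim (kernel (g + h.+1 - 1) inner) <= 1)%N.
Proof.
move=> xu; rewrite -[leqRHS](cards1 (psi 0)); apply: dimv_determined => x xK /(_ _ (set11 _)).
exact: (cycle_kernel_last xK (xu x xK)).
Qed.

End Cycle.
End SpecialPieces.

(** * Rooting the tree of hubs *)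

Section RootedTree.
Variables (T J : finType) (G : {set T}) (a b : J -> T) (r : T).

Definition joined : rel T := fun v w => [exists j, [set a j; b j] == [set v; w]].

Hypothesis r_in : r \in G.
Hypothesis ends_in : forall j, a j \in G /\ b j \in G.
Hypothesis card_J : #|J| = (#|G| - 1)%N.
Hypothesis joined_conn : forall v, v \in G -> connect joined r v.

Fixpoint ball n : {set T} :=
  if n is m.+1 then [set w | (w \in ball m) || [exists v, (v \in ball m) && joined v w]]
  else [set r].

Lemma connect_ball v : connect joined r v -> exists n, v \in ball n.
Proof.
case/connectP => p; elim/last_ind: p v => [|p w IH] v /=.
  by move=> _ ->; exists 0%N; rewrite inE.
rewrite rcons_path last_rcons => /andP[rp pw] ->.
have [n nP] := IH _ rp erefl; exists n.+1.
by rewrite inE; apply/orP; right; apply/existsP; exists (last r p); rewrite nP.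
Qed.

(* Breadth-first search from [r] gives every vertex of [G] other than [r] an
   edge to a vertex closer to [r]; as there are only [#|G| - 1] edges, this is a
   bijection between edges and vertices other than [r]. *)
Lemma rooted_tree : exists (child parent : J -> T) (d : T -> nat),
  [/\ injective child, forall j, (d (parent j) < d (child j))%N
    & forall j, (child j = a j /\ parent j = b j) \/ (child j = b j /\ parent j = a j)].
Proof.
have [d dP] : exists d : T -> nat, forall v, v \in G ->
    v \in ball (d v) /\ forall n, v \in ball n -> (d v <= n)%N.
  apply: (@fin_all_exists _ (fun=> nat)
    (fun v n => v \in G -> v \in ball n /\ forall m, v \in ball m -> (n <= m)%N)).
  move=> v; have [vG|_] := boolP (v \in G); last by exists 0%N.
  have [n nP min] := ex_minnP (connect_ball (joined_conn vG)).
  by exists n.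
have edge_up v : v \in G -> v != r ->
    exists2 j, [set a j; b j] = [set v; if v == a j then b j else a j]
             & (d (if v == a j then b j else a j) < d v)%N.
  move=> vG vr; have [] := dP v vG; case E: (d v) => [|n].
    by rewrite inE (negbTE vr).
  rewrite inE => /orP[vn /(_ _ vn)|/existsP[w /andP[wn /existsP[j /eqP jE]]] _].
    by rewrite ltnn.
  have : w \in [set a j; b j] by rewrite jE !inE eqxx.
  have : v \in [set a j; b j] by rewrite jE !inE eqxx orbT.
  have wv : w != v.
    by apply: contraTneq wn => ->; apply/negP => /(proj2 (dP v vG)); rewrite E ltnn.
  have [ajG bjG] := ends_in j.
  rewrite !inE => /orP[] /eqP vE /orP[] /eqP wE; subst v w; rewrite ?eqxx // in wv *.
    by exists j; rewrite eqxx // ltnS; apply: (proj2 (dP _ bjG)).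
  exists j; rewrite eq_sym (negbTE wv) 1?setUC //.
  by rewrite ltnS; apply: (proj2 (dP _ ajG)).
(* The child is the end farther from [r]. In a tie [a j] is taken; ties are excluded at the end,
   when [child] is known to be injective with image [G :\ r]. *)
pose child j := if (d (a j) < d (b j))%N then b j else a j.
pose parent j := if (d (a j) < d (b j))%N then a j else b j.
have child_up v : v \in G -> v != r -> exists2 j, child j = v & (d (parent j) < d v)%N.
  move=> vG vr; have [j jE jlt] := edge_up v vG vr; exists j.
    have : v \in [set a j; b j] by rewrite jE !inE eqxx.
    rewrite /child !inE => /orP[] /eqP vE; move: jlt; rewrite vE.
      by rewrite eqxx => /ltnW; rewrite leqNgt => /negbTE ->.
    by case: (eqVneq (b j) (a j)) => [->|_ ->]; rewrite ?ltnn.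
  have : v \in [set a j; b j] by rewrite jE !inE eqxx.
  rewrite /parent !inE => /orP[] /eqP vE; move: jlt; rewrite vE.
    rewrite eqxx => jlt; have := ltnW jlt; rewrite leqNgt => /negbTE ->; exact: jlt.
  by case: (eqVneq (b j) (a j)) => [->|_ jlt]; rewrite ?ltnn // jlt.
have card_G : #|G :\ r| = (#|G| - 1)%N by rewrite (cardsD1 r G) r_in addKn.
have sub_img : G :\ r \subset child @: setT.
  apply/subsetP => v; rewrite !inE => /andP[vr vG].
  by have [j <- _] := child_up v vG vr; apply: imset_f.
have img_card : #|child @: setT| = #|J|.
  apply/eqP; rewrite eqn_leq card_J -card_G (subset_leq_card sub_img) andbT.
  by rewrite card_G -card_J -cardsT leq_imset_card.
have child_inj : injective child.
  have /imset_injP cI : #|child @: setT| == #|[set: J]| by rewrite img_card cardsT.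
  by move=> i j; apply: cI; rewrite inE.
have imgE : child @: setT = G :\ r.
  by apply/esym/eqP; rewrite eqEcard sub_img img_card card_J card_G /=.
exists child, parent, d; split => // j; last first.
  by rewrite /child /parent; case: ifP; auto.
have : child j \in G :\ r by rewrite -imgE imset_f.
rewrite !inE => /andP[cr cG]; have [i ij] := child_up _ cG cr.
by rewrite (child_inj _ _ ij).
Qed.

End RootedTree.

(** * Counting incidences at the support of the cokernel *)

Section Counting.
Variables (T S J : finType) (att : S -> T) (a b child parent : J -> T) (d : T -> nat).
Variables (defS : S -> nat) (defJ : J -> nat) (X : {set T}).

Hypothesis child_inj : injective child.
Hypothesis parent_lt : forall j, (d (parent j) < d (child j))%N.
Hypothesis child_ends : forall j,
  (child j = a j /\ parent j = b j) \/ (child j = b j /\ parent j = a j).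
Hypothesis X_inc : forall v, v \in X ->
  (3 <= #|[set s | att s == v]| + #|[set j | (v == a j) || (v == b j)]|)%N.
Hypothesis X_att : forall s, att s \in X -> (1 <= defS s)%N.
Hypothesis X_ends : forall j, defJ j = 0%N -> (a j \in X) = (b j \in X).

Let inX j := (a j \in X) && (b j \in X).
Let tightX j := inX j && (defJ j == 0%N).

(** Double counting of the pairs formed by a vertex of [X] and a pendant piece or link at it. *)
Lemma sum_incidences : (3 * #|X| <= \sum_s (att s \in X) +
   \sum_j ((a j \in X) + (b j \in X)))%N.
Proof.
have swap (I : finType) (f : I -> pred T) :
  (\sum_(v in X) #|[set s | f s v]| = \sum_s #|[set v in X | f s v]|)%N.
  under eq_bigr do rewrite -sum1_card big_mkcond.
  rewrite exchange_big; apply: eq_bigr => s _.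
  rewrite -sum1_card big_mkcond [RHS]big_mkcond; apply: eq_bigr => v _.
  by rewrite !inE; case: (v \in X); case: (f s v).
have : (\sum_(v in X) 3 <= \sum_(v in X) (#|[set s | att s == v]| +
          #|[set j | (v == a j) || (v == b j)]|))%N by apply: leq_sum.
rewrite sum_nat_const mulnC => /leq_trans; apply.
rewrite big_split (swap _ (fun s v => att s == v)) /=.
rewrite (swap _ (fun j v => (v == a j) || (v == b j))).
apply: leq_add; apply: leq_sum => s _.
  have [sX|sX] := boolP (att s \in X).
    rewrite -[nat_of_bool true](cards1 (att s)); apply/subset_leq_card/subsetP => v.
    by rewrite !inE eq_sym => /andP[].
  rewrite leqn0 cards_eq0; apply/eqP/setP => v; rewrite !inE; apply/negbTE.
  by apply: contra sX => /andP[vX /eqP ->].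
have le1 w : (#|[set v in X | v == w]| <= (w \in X))%N.
  have [wX|wX] := boolP (w \in X).
    rewrite -[nat_of_bool true](cards1 w); apply/subset_leq_card/subsetP => v.
    by rewrite !inE => /andP[].
  rewrite leqn0 cards_eq0; apply/eqP/setP => v; rewrite !inE; apply/negbTE.
  by apply: contra wX => /andP[vX /eqP <-].
apply: leq_trans (leq_add (le1 (a s)) (le1 (b s))).
apply: leq_trans (leq_card_setU _ _); apply/subset_leq_card/subsetP => v.
by rewrite !inE => /andP[->].
Qed.

Lemma child_inX j : inX j -> child j \in X /\ parent j \in X.
Proof. by case/andP => aX bX; case: (child_ends j) => -[-> ->]. Qed.

(** The links inside [X] form a forest: [child] injects them into [X] and misses a vertex of [X] of
    least depth, whose parent would be a shallower vertex of [X]. *)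
Lemma card_inX : X != set0 -> (#|[set j | inX j]| < #|X|)%N.
Proof.
case/set0Pn => v0 v0X; have [v vX vmin] : exists2 v, v \in X & forall w, w \in X -> (d v <= d w)%N.
  by case: (arg_minnP d v0X) => v; exists v.
rewrite (cardsD1 v X) vX ltnS -(card_imset _ child_inj).
apply/subset_leq_card/subsetP => w /imsetP[j]; rewrite inE => /child_inX[cX pX] -> {w}.
rewrite !inE cX andbT; apply/eqP => cv.
by have := parent_lt j; rewrite cv ltnNge vmin.
Qed.

Lemma card_tightX :
  (#|[set j | tightX j]| + #|X :\: child @: [set j | defJ j == 0%N]| <= #|X|)%N.
Proof.
rewrite -[leqRHS](cardsID (child @: [set j | defJ j == 0%N]) X) leq_add2r.
rewrite -(card_imset _ child_inj); apply/subset_leq_card/subsetP => w /imsetP[j].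
rewrite !inE => /andP[/child_inX[cX _] d0] -> {w}; rewrite cX /=.
by apply: imset_f; rewrite inE.
Qed.

(** A link has at most [defJ j + inX j + tightX j] ends in [X], since one with a single end there is
    deficient. With [X'] the set on the left and [delta] the right-hand side, [3 |X| <= delta + (|X|
    - 1) + (|X| - |X'|)], hence [delta >= |X| + |X'| + 1 >= 2 |X'| + 1]. *)
Lemma deficiency_bound : X != set0 ->
  (2 * #|X :\: child @: [set j | defJ j == 0%N]| < \sum_s defS s + \sum_j defJ j)%N.
Proof.
move=> X0; have := card_inX X0; have := card_tightX; have := sum_incidences.
have : (\sum_s (att s \in X) <= \sum_s defS s)%N.
  by apply: leq_sum => s _; case: (boolP (_ \in X)) => // /X_att.
have : (\sum_j ((a j \in X) + (b j \in X)) <=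
        \sum_j defJ j + #|[set j | inX j]| + #|[set j | tightX j]|)%N.
  rewrite -!sum1dep_card ![(\sum_(j | _) _)%N]big_mkcond -!big_split /=.
  apply: leq_sum => j _; have := @X_ends j; rewrite /tightX /inX.
  by case: (defJ j) => [/(_ erefl) ->|n _]; case: (a j \in X); case: (b j \in X) => /=; lia.
lia.
Qed.

End Counting.

(** * Hubs joined by links and carrying pendant pieces *)

Section Network.
Variables (R : realType) (T : finType) (e : rel T) (lam : R).
Hypothesis e_sym : symmetric e.
Local Notation V := {ffun T -> R^o}.
Local Notation D := (lapD e lam).
Local Notation ker A := (kerc D A).

(* [G] is a set of hubs; deleting it leaves pendant pieces [B (inl s)], joined
   to the hub [att s] through the single vertex [u s], and links [B (inr j)]
   between the hubs [a j] and [b j], with first vertex [fst_nbr j] and last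
   vertex [lst_nbr j].  For a link without vertices, [fst_nbr j] and
   [lst_nbr j] are [b j] and [a j]. *)
Variables (G : {set T}) (S J : finType) (B : S + J -> {set T}).
Variables (att u : S -> T) (a b fst_nbr lst_nbr : J -> T) (max_mult : S -> nat).

Hypothesis B_cover : \bigcup_i B i = ~: G.
Hypothesis B_disjoint : forall i j, i != j -> [disjoint B i & B j].
Hypothesis B_separated : forall i j x y,
  i != j -> x \in B i -> y \in B j -> ~~ e x y.
Hypothesis att_in : forall s, att s \in G.
Hypothesis ends_in : forall j, a j \in G /\ b j \in G.
Hypothesis ends_neq : forall j, a j != b j.
Hypothesis pendant_edge : forall s y v, y \in B (inl s) -> v \in G ->
  e y v = (y == u s) && (v == att s).
Hypothesis u_in : forall s, u s \in B (inl s).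
Hypothesis link_edge : forall j y v, y \in B (inr j) -> v \in G ->
  e y v = (y == fst_nbr j) && (v == a j) || (y == lst_nbr j) && (v == b j).
Hypothesis link_nbrs_in : forall j, B (inr j) != set0 ->
  fst_nbr j \in B (inr j) /\ lst_nbr j \in B (inr j).
Hypothesis hub_edge : forall v w, v \in G -> w \in G -> e v w -> exists j,
  [/\ v = a j, w = b j & w = fst_nbr j] \/ [/\ v = b j, w = a j & w = lst_nbr j].
Hypothesis dim_pendant : forall s, (\dim (ker (B (inl s))) <= max_mult s)%N.
Hypothesis dim_pendant_u : forall s,
  (forall x, x \in ker (B (inl s)) -> x (u s) = 0) ->
  (\dim (ker (B (inl s))) < max_mult s)%N.
Hypothesis dim_link : forall j, (\dim (ker (B (inr j))) <= 1)%N.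
Hypothesis link_fst : forall j x, x \in ker (B (inr j)) -> x (fst_nbr j) = 0 -> x = 0.
Hypothesis link_lst : forall j x, x \in ker (B (inr j)) -> x (lst_nbr j) = 0 -> x = 0.
Hypothesis hub_deg : forall v, v \in G -> (3 <= deg e v)%N.
Hypothesis e_conn : forall v w, connect e v w.
Variable r : T.
Hypothesis r_in : r \in G.
Hypothesis card_J : #|J| = (#|G| - 1)%N.

Lemma piece_notin_hub i v : v \in B i -> v \notin G.
Proof. by move=> vi; rewrite -in_setC -B_cover; apply/bigcupP; exists i. Qed.

Lemma notin_hubP v : v \notin G -> exists i, v \in B i.
Proof. by rewrite -in_setC -B_cover => /bigcupP[i _]; exists i. Qed.

Lemma piece_uniq i j v : v \in B i -> v \in B j -> i = j.
Proof.
move=> vi vj; apply/eqP/negP => /negP /B_disjoint dij.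
by rewrite (disjointFr dij vi) in vj.
Qed.

(** Each neighbour of [v] is the contact vertex [u s] of a pendant piece at [v], or the neighbour of
    [v] along a link ending at [v]. *)
Lemma hub_deg_incidence v : v \in G ->
  (deg e v <= #|[set s | att s == v]| + #|[set j | (v == a j) || (v == b j)]|)%N.
Proof.
move=> vG; pose link_nbr j := if v == a j then fst_nbr j else lst_nbr j.
pose IS := [set s | att s == v]; pose IJ := [set j | (v == a j) || (v == b j)].
apply: leq_trans (leq_add (leq_imset_card u (mem IS)) (leq_imset_card link_nbr (mem IJ))).
apply: leq_trans (leq_card_setU _ _); apply/subset_leq_card/subsetP => y.
rewrite inE => vy; apply/setUP; have [yG|/notin_hubP[[s|j] yB]] := boolP (y \in G).
- right; apply/imsetP; have [j [[va yb yf]|[vb ya yl]]] := hub_edge vG yG vy.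
    by exists j; rewrite ?inE /link_nbr va eqxx.
  exists j; first by rewrite inE vb eqxx orbT.
  by rewrite /link_nbr vb eq_sym (negbTE (ends_neq j)).
- left; move: vy; rewrite e_sym (pendant_edge yB vG) => /andP[/eqP -> /eqP vs].
  by apply: imset_f; rewrite inE vs.
right; apply/imsetP; exists j; move: vy; rewrite e_sym (link_edge yB vG) ?inE.
  by case/orP => /andP[_ ->]; rewrite ?orbT.
rewrite /link_nbr; case/orP => /andP[/eqP -> /eqP ->]; rewrite ?eqxx //.
by rewrite eq_sym (negbTE (ends_neq j)).
Qed.

Lemma joined_links j : joined a b (a j) (b j) && joined a b (b j) (a j).
Proof. by apply/andP; split; apply/existsP; exists j; rewrite // setUC. Qed.

Lemma hubs_connected v : v \in G -> connect (joined a b) r v.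
Proof.
have joined_ab j := andP (joined_links j).
have piece_conn i y y' v' w : y \in B i -> y' \in B i -> v' \in G -> w \in G ->
    e y v' -> e y' w -> connect (joined a b) v' w.
  case: i => [s|j] yB yB' vG wG.
    by rewrite (pendant_edge yB vG) (pendant_edge yB' wG) => /andP[_ /eqP ->] /andP[_ /eqP ->].
  have [ab ba] := joined_ab j; rewrite (link_edge yB vG) (link_edge yB' wG).
  case/orP => /andP[_ /eqP ->] /orP[] /andP[_ /eqP ->] //; exact: connect1.
(* Invariant along a path of [e] from [r]: a hub on it is reachable from [r] through links, and so
   is every hub adjacent to a piece that the path visits. *)
pose good y := (y \in G -> connect (joined a b) r y) /\
  (forall i y' w, y \in B i -> y' \in B i -> w \in G -> e y' w -> connect (joined a b) r w).
suff good_path p x : good x -> path e x p -> good (last x p).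
  have /connectP[p rp ->] := e_conn r v; apply: (proj1 (good_path p r _ rp)).
  split=> // i y' w /piece_notin_hub; by rewrite r_in.
elim: p x => [|y p IH] x //= [gx1 gx2] /andP[xy yp]; apply: (IH y) => {yp} //.
have [xG|xN] := boolP (x \in G).
  split=> [yG|i y' w yB yB' wG ew].
    have [j jE] := hub_edge xG yG xy; have [ab ba] := joined_ab j.
    by apply: connect_trans (gx1 xG) (connect1 _); case: jE => -[-> -> _].
  rewrite (connect_trans (gx1 xG)) //; apply: (piece_conn i y y') => //.
  by rewrite e_sym.
have [i xi] := notin_hubP xN; split=> [yG|k y' w yk]; first exact: (gx2 i x).
have <- : i = k by apply/eqP; apply: contraTT xy => ik; apply: (B_separated ik).
exact: gx2.
Qed.

Lemma lapD_outside i j x v :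
  i != j -> x \in fsupp R (B i) -> v \in B j -> D x v = 0.
Proof.
move=> ij /fsuppP x0 vj; have xv : x v = 0.
  by apply: x0; apply/negP => vi; rewrite (piece_uniq vi vj) eqxx in ij.
rewrite lapD_deg xv mulr0 sub0r big1 ?oppr0 // => w _.
have [wi|/x0 ->] := boolP (w \in B i); last by rewrite mulr0.
by rewrite e_sym (negbTE (B_separated ij wi vj)) mul0r.
Qed.

Lemma dim_ker_pieces :
  (\dim (ker (~: G)) = \sum_s \dim (ker (B (inl s))) + \sum_j \dim (ker (B (inr j))))%N.
Proof.
rewrite -B_cover dim_kerc_bigcup // ?big_sumType //.
exact: lapD_outside.
Qed.

Lemma ker_piece_sub i : (ker (B i) <= ker (~: G))%VS.
Proof.
apply/subvP => x xK; have [x0 Dx0] := kercP _ _ _ xK.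
apply/kercP; rewrite -B_cover; split => [v vN|v /bigcupP[j _ vj]].
  by apply: x0; apply: contra vN => vi; apply/bigcupP; exists i.
have [ij|ij] := eqVneq i j; first by apply: Dx0; rewrite ij.
by apply: (lapD_outside ij) vj; apply/fsuppP.
Qed.

(** As [z] vanishes on the hubs, [D z] at a hub is minus the sum of [z] over its neighbours, so this
    is orthogonality of [al] to [D z] up to sign. *)
Lemma coker_piece i al z : al \in coker D G -> z \in ker (B i) ->
  \sum_(v in G) al v * (\sum_(w in B i) (e w v)%:R * z w) = 0.
Proof.
move=> /cokerP[al0 al_orth] zK; have := al_orth z (subvP (ker_piece_sub i) z zK).
case/kercP: zK => z0 _ /eqP; rewrite -oppr_eq0 => /eqP; apply: etrans.
rewrite /dot -sumrN big_mkcond /=; apply: eq_bigr => v _.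
case: ifPn => [vG|/al0 ->]; last by rewrite mul0r oppr0.
rewrite lapD_deg (z0 v); last by apply/negP => /piece_notin_hub; rewrite vG.
rewrite mulr0 sub0r mulrN opprK big_mkcond; congr (_ * _); apply: eq_bigr => w _ /=.
by rewrite e_sym; case: ifPn => // /z0 ->; rewrite mulr0.
Qed.

(** A single edge leaves the piece, so one term survives. Hence if [al] is nonzero at [att s], all
    kernel functions of the piece vanish at [u s], and the piece is deficient. *)
Lemma coker_pendant s al z : al \in coker D G -> z \in ker (B (inl s)) ->
  al (att s) * z (u s) = 0.
Proof.
move=> alK zK; rewrite -[RHS](coker_piece alK zK) (bigD1 (att s)) //=.
rewrite (bigD1 (u s)) //= (pendant_edge (s := s)) // !eqxx mul1r.
rewrite big1 ?addr0 => [|w /andP[wB wu]].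
  rewrite big1 ?addr0 // => v /andP[vG va]; rewrite big1 ?mulr0 // => w wB.
  by rewrite (pendant_edge (s := s)) // (negbTE va) andbF mul0r.
by rewrite (pendant_edge (s := s)) // (negbTE wu) mul0r.
Qed.

Lemma coker_link j al z : al \in coker D G -> z \in ker (B (inr j)) ->
  B (inr j) != set0 ->
  al (a j) * z (fst_nbr j) + al (b j) * z (lst_nbr j) = 0.
Proof.
move=> alK zK /link_nbrs_in[fB lB]; rewrite -[RHS](coker_piece alK zK).
have [aG bG] := ends_in j; have ab := ends_neq j; have ba : b j != a j by rewrite eq_sym.
rewrite (bigD1 (a j)) // (bigD1 (b j)) /=; last by rewrite bG.
rewrite [X in _ + (_ + X)]big1 ?addr0 => [|v /andP[/andP[vG va] vb]].
  congr (_ * _ + _ * _).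
    rewrite (bigD1 (fst_nbr j)) //= (link_edge (j := j)) // !eqxx mul1r.
    rewrite big1 ?addr0 // => w /andP[wB wf].
    by rewrite (link_edge (j := j)) // (negbTE wf) (negbTE ab) andbF mul0r.
  rewrite (bigD1 (lst_nbr j)) //= (link_edge (j := j)) // !eqxx orbT mul1r.
  rewrite big1 ?addr0 // => w /andP[wB wf].
  by rewrite (link_edge (j := j)) // (negbTE wf) (negbTE ba) andbF mul0r.
rewrite big1 ?mulr0 // => w wB.
by rewrite (link_edge (j := j)) // (negbTE va) (negbTE vb) !andbF mul0r.
Qed.

Lemma coker_link_ends j : \dim (ker (B (inr j))) = 1%N -> exists p q : R,
  [/\ p != 0, q != 0 & forall al, al \in coker D G -> al (a j) * p + al (b j) * q = 0].
Proof.
(* The coefficients [p] and [q] are the values of a nonzero kernel function at the two end vertices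
   of the link; neither vanishes, since either zero would force [z = 0]. *)
move=> dim1; pose z := vpick (ker (B (inr j))).
have z0 : z != 0 by rewrite vpick0 -dimv_eq0 dim1.
have zK : z \in ker (B (inr j)) := memv_pick _.
have B0 : B (inr j) != set0.
  apply: contraNneq z0 => B0; apply/eqP/ffunP => v; rewrite ffunE.
  by case/kercP: zK => -> //; rewrite B0 inE.
exists (z (fst_nbr j)), (z (lst_nbr j)); split; last by move=> al alK; apply: coker_link.
  by apply: contraNneq z0 => /(link_fst zK) ->.
by apply: contraNneq z0 => /(link_lst zK) ->.
Qed.

Theorem network_multiplicity :
  (\dim (ker setT)).+1 = (\sum_s max_mult s)%N <->
  (forall s, \dim (ker (B (inl s))) = max_mult s) /\
  (forall j, \dim (ker (B (inr j))) = 1%N).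
Proof.
pose defS s := (max_mult s - \dim (ker (B (inl s))))%N.
pose defJ j := (1 - \dim (ker (B (inr j))))%N.
(* The union of the supports of the functions in [coker D G], with a decidable condition. *)
pose X := [set v | ~~ (coker D G <= fsupp R (~: [set v]))%VS].
have XP v : reflect (exists2 al, al \in coker D G & al v != 0) (v \in X).
  rewrite inE; apply: (iffP idP) => [/subvPn[al alK alv]|[al alK alv]].
    exists al => //; apply: contraNneq alv => alv; apply/fsuppP => w; rewrite !inE negbK.
    by move=> /eqP ->.
  apply/subvPn; exists al => //; apply: contraNN alv => /fsuppP ->//.
  by rewrite !inE eqxx.
have notX v al : v \notin X -> al \in coker D G -> al v = 0.
  by move=> vX alK; apply: contraNeq vX => alv; apply/XP; exists al.
have defJ0 j : defJ j = 0%N -> \dim (ker (B (inr j))) = 1%N.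
  by have := dim_link j; rewrite /defJ; lia.
have [child [parent [d [child_inj parent_lt child_ends]]]] :=
  rooted_tree r_in ends_in card_J hubs_connected.
have G_X v : v \in X -> v \in G.
  by case/XP => al /cokerP[al0 _]; apply: contraR => /al0 ->.
have X_inc v : v \in X ->
    (3 <= #|[set s | att s == v]| + #|[set j | (v == a j) || (v == b j)]|)%N.
  by move/G_X => vG; apply: leq_trans (hub_deg vG) (hub_deg_incidence vG).
have X_att s : att s \in X -> (1 <= defS s)%N.
  case/XP => al alK al0; rewrite /defS subn_gt0; apply: dim_pendant_u => z zK.
  by apply/eqP; have /eqP := coker_pendant alK zK; rewrite mulf_eq0 (negbTE al0).
have X_ends j : defJ j = 0%N -> (a j \in X) = (b j \in X).
  move/defJ0/coker_link_ends => [p [q [p0 q0 rel]]].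
  apply/XP/XP => -[al alK al0]; exists al => //; apply: contraNneq al0 => al0;
    have /eqP := rel al alK;
    by rewrite al0 mul0r ?add0r ?addr0 mulf_eq0 ?(negbTE p0) ?(negbTE q0) orbF.
(* A cokernel function is determined by its values on [X']: at any other vertex of [X], a
   non-deficient link gives its value from that at the parent. The induction is on the depth [d]. *)
pose X' := X :\: child @: [set j | defJ j == 0%N].
have dim_coker : (\dim (coker D G) <= #|X'|)%N.
  apply: dimv_determined => al alK alX'.
  suff al0 n v : (d v < n)%N -> al v = 0 by apply/ffunP => v; rewrite ffunE (al0 (d v).+1).
  elim: n v => // n IH v dv; have [vX|/notX -> //] := boolP (v \in X).
  have [/imsetP[j]|vc] := boolP (v \in child @: [set j | defJ j == 0%N]); last first.
    by apply: alX'; rewrite inE vc.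
  rewrite inE => /eqP/defJ0/coker_link_ends[p [q [p0 q0 rel]]] vE.
  have /IH alp : (d (parent j) < n)%N by have := parent_lt j; rewrite -vE; lia.
  apply/eqP; have /eqP := rel al alK; rewrite vE.
  case: (child_ends j) alp => -[-> ->] ->; rewrite mul0r ?add0r ?addr0 mulf_eq0.
    by rewrite (negbTE p0) orbF.
  by rewrite (negbTE q0) orbF.
have := deficiency_bound child_inj parent_lt child_ends X_inc X_att X_ends.
rewrite -/X'; set delta := (\sum_s _ + _)%N => bound.
have deltaE : (\dim (ker (~: G)) + delta = \sum_s max_mult s + #|J|)%N.
  rewrite dim_ker_pieces /delta addnACA -!big_split /=; congr (_ + _)%N.
    by apply: eq_bigr => s _; rewrite /defS subnKC.
  by rewrite -sum1_card; apply: eq_bigr => j _; rewrite /defJ subnKC.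
have le1 := dim_kercC_leq D G; have le2 := dim_kerc_leqC (lapD_adj e_sym lam) G.
have G0 : (0 < #|G|)%N by apply/card_gt0P; exists r.
have X'0 : X = set0 -> #|X'| = 0%N by move=> X0; rewrite /X' X0 set0D cards0.
have optE : (\dim (ker setT)).+1 = (\sum_s max_mult s)%N <-> delta = 0%N.
  (* In order: the multiplicity of [lam], the kernel dimension over the pieces, the deficiency, the
     sum of the pendant bounds, the number of hubs, the dimension of the cokernel, and [#|X'|]. *)
  have arith v w dl m n k x : (0 < n -> w + dl = m + (n - 1) -> k <= x ->
      w <= v + n -> v + n <= w + k.*2 -> x = 0 \/ 2 * x < dl ->
      (v.+1 = m <-> dl = 0))%N by lia.
  apply: (arith _ _ _ _ _ _ _ G0 _ dim_coker le1 le2); first by rewrite -card_J.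
  by have [/X'0|/bound] := eqVneq X set0; [left | right].
rewrite optE; split=> [delta0|[dS dJ]].
  move/eqP: delta0; rewrite addn_eq0 !sum_nat_eq0 => /andP[/forallP dS /forallP dJ].
  split=> [s|j]; last by apply: defJ0; apply/eqP; apply: dJ.
  by apply/eqP; rewrite eqn_leq dim_pendant -subn_eq0; apply: dS.
apply/eqP; rewrite addn_eq0 !sum_nat_eq0; apply/andP; split; apply/forallP => i /=.
  by rewrite /defS dS subnn.
by rewrite /defJ dJ.
Qed.

End Network.

(** * From the decomposition to embedded models *)

Section Embeddings.
Variables (T : finType) (e : rel T).

(** The hub [v] to which the copy is attached becomes position [n], right after the last vertex. *)
Definition extend n (f : 'I_n -> T) (v : T) (i : nat) : T :=
  if insub i is Some x then f x else v.

Lemma extend_ord n (f : 'I_n -> T) v (x : 'I_n) : extend f v x = f x.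
Proof. by rewrite /extend valK. Qed.

Lemma extend_lt n (f : 'I_n -> T) v i (lt_i : (i < n)%N) :
  extend f v i = f (Ordinal lt_i).
Proof. by rewrite -(extend_ord f v). Qed.

Lemma extend_end n (f : 'I_n -> T) v : extend f v n = v.
Proof. by rewrite /extend insubN // ltnn. Qed.

Lemma extend_inj n (f : 'I_n -> T) v : injective f -> v \notin vset f ->
  forall i j, (i <= n)%N -> (j <= n)%N -> extend f v i = extend f v j -> i = j.
Proof.
move=> f_inj vN i j; rewrite (leq_eqVlt i) (leq_eqVlt j).
move=> /orP[/eqP ->|lt_i] /orP[/eqP ->|lt_j] //; rewrite ?extend_end ?extend_lt.
- by move=> vE; rewrite vE imset_f in vN.
- by move=> vE; rewrite -vE imset_f in vN.
by move/f_inj => -[].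
Qed.

Lemma inner_set_extend n N (f : 'I_n -> T) v : (n <= N)%N ->
  inner_set N (fun i => i < n)%N (extend f v) = vset f.
Proof.
move=> nN; apply/setP => y; apply/imsetP/imsetP => [[i]|[x _ ->]].
  by rewrite inE => lt_i ->; exists (Ordinal lt_i) => //; apply: extend_lt.
by exists (widen_ord nN x); rewrite ?inE //= extend_ord.
Qed.

Section Pendant.
Variables (n : nat) (f : 'I_n -> T) (v : T) (adj : rel 'I_n).
Hypothesis n_gt0 : (0 < n)%N.
Hypothesis f_copy : induced_copy e adj f.
Hypothesis v_notin : v \notin vset f.
Hypothesis v_attached : forall (x : 'I_n) (y : T),
  y \notin vset f -> e (f x) y = is_last x && (y == v).

(** The copy together with its hub is the model with one more path vertex, as in the definitions of
    [Bmx] and [Qmx]: the new position [n] is adjacent only to [n.-1]. *)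
Lemma extend_realizes N (b : rel nat) : N = n.+1 ->
  (forall x y, adj x y = b x y) -> (forall i, (i < n)%N -> b i n = (i.+1 == n)) ->
  realizes e N (fun i => i < n)%N b (extend f v).
Proof.
have [f_inj f_adj] := f_copy => -> adjE b_end; split=> [i j iN jN|i z iN lt_i].
  exact: extend_inj.
rewrite extend_lt; have [/imsetP[y _ ->]|zN] := boolP (z \in vset f).
  rewrite f_adj adjE; apply/idP/existsP => [bxy|[j /andP[bij]]].
    exists (widen_ord (leqnSn n) y); apply/andP; split=> //=.
    by rewrite extend_ord.
  rewrite -(extend_ord f v y) => /eqP/(extend_inj f_inj v_notin) -> //.
    exact: ltnW.
  by rewrite -ltnS.
rewrite v_attached // /is_last -b_end //=; apply/andP/existsP => [[bin /eqP ->]|[j]].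
  by exists ord_max; rewrite /= bin extend_end eqxx.
case/andP => bij /eqP zE; have jn : nat_of_ord j = n.
  apply: contraNeq zN => jn; have lt_j : (j < n)%N by rewrite ltn_neqAle jn -ltnS ltn_ord.
  by rewrite zE extend_lt imset_f.
by rewrite -jn bij zE jn extend_end eqxx.
Qed.

Lemma pendant_last_in : extend f v n.-1 \in vset f.
Proof.
have lt_p : (n.-1 < n)%N by rewrite ltn_predL.
by rewrite extend_lt imset_f.
Qed.

Lemma pendant_edges y w : y \in vset f -> w \notin vset f ->
  e y w = (y == extend f v n.-1) && (w == v).
Proof.
case/imsetP => x _ -> wN; rewrite v_attached // /is_last; congr (_ && _).
have lt_p : (n.-1 < n)%N by rewrite ltn_predL.
rewrite extend_lt (inj_eq (proj1 f_copy)) -val_eqE /=.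
by rewrite -[RHS]eqSS prednK.
Qed.

End Pendant.

(** The hubs occupy positions [0] and [n.+1], the copy the positions between. For [n = 0], positions
    [1] and [n] are [b] and [a], which agrees with the convention for links without vertices. *)
Definition link_map n (f : 'I_n -> T) (a b : T) (i : nat) : T :=
  if i is i'.+1 then extend f b i' else a.

Lemma link_map_empty n (f : 'I_n -> T) a b : n = 0%N ->
  link_map f a b 1 = b /\ link_map f a b n = a.
Proof. by case: n f => // f _; rewrite /= extend_end. Qed.

Section Link.
Variables (t : nat) (f : 'I_t -> T) (a b : T).
Hypothesis f_copy : induced_copy e (@path_graph t) f.
Hypothesis f_joins : joins e f a b.
Hypothesis a_notin : a \notin vset f.
Hypothesis b_notin : b \notin vset f.

Lemma link_map_inj i j : (i < t.+2)%N -> (j < t.+2)%N ->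
  link_map f a b i = link_map f a b j -> i = j.
Proof.
have [[aG bG ab _] _] := f_joins.
have a_ne i' : (i' <= t)%N -> a <> extend f b i'.
  rewrite leq_eqVlt => /orP[/eqP -> |lt_i] aE.
    by move: ab; rewrite aE extend_end eqxx.
  by move: a_notin; rewrite aE extend_lt imset_f.
case: i j => [|i] [|j] //= iN jN; first by move/a_ne.
  by move/esym/a_ne.
by move/(extend_inj (proj1 f_copy) b_notin) => -> //.
Qed.

Lemma link_realizes : realizes e t.+2 (path_inner t) path_adj (link_map f a b).
Proof.
split=> [i j|]; first exact: link_map_inj.
case=> // i z iN; rewrite /path_inner => /andP[_ lt_i]; rewrite ltnS in lt_i.
have [_ /(_ (Ordinal lt_i))[deg2 e_first e_last]] := f_joins.
have psiE : link_map f a b i.+1 = f (Ordinal lt_i) by rewrite /= extend_lt.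
have e_prev : e (f (Ordinal lt_i)) (link_map f a b i).
  move: e_first; rewrite /is_first /=; case: (i) (lt_i) => [|k] lt_k; first exact.
  move=> _ /=; have lt_k' : (k < t)%N := ltnW lt_k.
  by rewrite extend_lt (proj2 f_copy) /path_graph /= eqxx orbT.
have e_next : e (f (Ordinal lt_i)) (link_map f a b i.+2).
  move: e_last; rewrite /is_last /=; have [->|it _] := eqVneq i.+1 t.
    by rewrite extend_end; apply.
  have lt_i1 : (i.+1 < t)%N by lia.
  by rewrite extend_lt (proj2 f_copy) /path_graph /= eqxx.
(* The two adjacent positions give two distinct neighbours, and the degree in [e] is 2, so there are
   no others. *)
have nbrs : [set link_map f a b i; link_map f a b i.+2] = [set y | e (f (Ordinal lt_i)) y].
  apply/eqP; rewrite eqEcard -/(deg e _) deg2 cards2; apply/andP; split.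
    by apply/subsetP => y; rewrite !inE => /orP[] /eqP ->.
  case: eqP => // /link_map_inj; lia.
have /setP/(_ z) := nbrs; rewrite psiE !inE => <-.
apply/orP/existsP => [|[j /andP[]]].
  have lt1 : (i < t.+2)%N by lia.
  have lt2 : (i.+2 < t.+2)%N by lia.
  by case=> /eqP ->; [exists (Ordinal lt1)|exists (Ordinal lt2)];
    rewrite /path_adj /= !eqxx ?orbT.
by rewrite /path_adj => /orP[/eqP ->|/eqP[->]] /eqP ->; [right|left].
Qed.

Lemma inner_set_link : inner_set t.+2 (path_inner t) (link_map f a b) = vset f.
Proof.
apply/setP => y; apply/imsetP/imsetP => [[[[|i] iN]]|[x _ ->]]; rewrite ?inE //.
  rewrite /path_inner => /andP[_ lt_i] ->; rewrite ltnS in lt_i.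
  by exists (Ordinal lt_i) => //; apply: extend_lt.
have lt_x : (x.+1 < t.+2)%N by have := ltn_ord x; lia.
exists (Ordinal lt_x); rewrite ?inE /path_inner /= ?extend_ord //.
by have := ltn_ord x; lia.
Qed.

Lemma link_edges y w : y \in vset f -> w \notin vset f ->
  e y w = (y == link_map f a b 1) && (w == a) || (y == link_map f a b t) && (w == b).
Proof.
have psi0 : link_map f a b 0 = a by [].
have psit : link_map f a b t.+1 = b by rewrite /= extend_end.
rewrite -inner_set_link => /imsetP[i]; rewrite inE => ii -> wN.
apply/idP/idP => [|/orP[] /andP[/eqP iE /eqP ->]].
- rewrite (proj2 link_realizes) // => /existsP[j /andP[bij /eqP wE]].
  have : ~~ path_inner t j by rewrite -(mem_inner_set link_realizes) // -wE.
  move: bij ii (ltn_ord i) (ltn_ord j); rewrite /path_adj /path_inner => bij ii it jt jN.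
  have [j0|j0] := eqVneq (nat_of_ord j) 0%N.
    have -> : nat_of_ord i = 1%N by lia.
    by rewrite wE j0 psi0 !eqxx.
  have -> : nat_of_ord i = t by lia.
  have jE : nat_of_ord j = t.+1 by lia.
  by rewrite wE jE psit !eqxx orbT.
- rewrite -[X in e _ X]psi0 (realizes_adj link_realizes) // /path_adj.
  by rewrite (link_map_inj _ _ iE) //; move: ii; rewrite /path_inner; lia.
rewrite -[X in e _ X]psit (realizes_adj link_realizes) // /path_adj.
by rewrite (link_map_inj _ _ iE) ?eqxx.
Qed.

Lemma link_ends_in : vset f != set0 ->
  link_map f a b 1 \in vset f /\ link_map f a b t \in vset f.
Proof.
case/set0Pn => _ /imsetP[x _ _]; have t_gt0 : (0 < t)%N by have := ltn_ord x; lia.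
rewrite -inner_set_link !(mem_inner_set link_realizes) // /path_inner.
by split; lia.
Qed.

End Link.
End Embeddings.

(** * Application to the decomposition of G - Gamma(G) *)

Theorem theorem2p2 (R : realType) (T : finType) (e : rel T)
    (e_sym : symmetric e) (e_irr : irreflexive e)
    (e_conn : connected_graph e)
    (c_ge1 : (1 <= cyclomatic e)%N)
    (cq_ge3 : (3 <= cyclomatic e + nb_quasi_pendant e)%N)
    (lam : R) (lam_neq1 : lam <> 1%R)
    (g h : 'I_(cyclomatic e) -> nat) (k l : 'I_(nb_quasi_pendant e) -> nat)
    (t : 'I_(#|Gamma e| - 1) -> nat)
    (D : decomposition g h k l t) :
  lambda_optimal e lam <->
  (forall m, mult (Qmx R (g m) (h m)) lam = 2%N) /\
  (forall i, mult (Bmx R (k i) (l i)) lam = 1%N) /\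
  (forall j, mult (Umx R (t j)) lam = 1%N).
Proof.
have [vc vcG vcP] := fin_all_exists2 (cyc_attached D).
have [vt vtG vtP] := fin_all_exists2 (tre_attached D).
have vset_notin s v : v \in Gamma e -> v \notin comps D s.
  move=> vG; apply: contraL vG => vs; rewrite -in_setC -(comps_cover D).
  by apply/bigcupP; exists s.
have cyc_notin m v : v \in Gamma e -> v \notin vset (@cyc _ _ _ _ _ _ _ D m).
  exact: (vset_notin (inl (inl m))).
have tre_notin i v : v \in Gamma e -> v \notin vset (@tre _ _ _ _ _ _ _ D i).
  exact: (vset_notin (inl (inr i))).
have pth_notin j v : v \in Gamma e -> v \notin vset (@pth _ _ _ _ _ _ _ D j).
  exact: (vset_notin (inr j)).
pose psic m := extend (@cyc _ _ _ _ _ _ _ D m) (vc m).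
pose psit i := extend (@tre _ _ _ _ _ _ _ D i) (vt i).
pose psip j := link_map (@pth _ _ _ _ _ _ _ D j) (end1 D j) (end2 D j).
have nc m : (0 < g m + h m - 1)%N by have := g_ge3 D m; lia.
have nt i : (0 < k i + l i)%N by have := l_ge1 D i; lia.
have real_c m : realizes e (g m + (h m).+1 - 1)
    (fun i : nat => i < g m + h m - 1)%N (cycle_adj (g m)) (psic m).
  apply: (extend_realizes (cyc_copy D m) (cyc_notin _ _ (vcG m)) (vcP m)) => //.
  - by have := g_ge3 D m; lia.
  - have := g_ge3 D m; have := h_ge1 D m.
    by move=> h1 g3 i lt_i; rewrite /cycle_adj /cycle_arc; lia.
have real_t i : realizes e (k i + (l i).+1)
    (fun j : nat => j < k i + l i)%N (tree_adj (k i)) (psit i).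
  apply: (extend_realizes (tre_copy D i) (tre_notin _ _ (vtG i)) (vtP i)) => //.
  - by rewrite addnS.
  - have := l_ge1 D i => l1 j lt_j; rewrite /tree_adj /tree_arc.
    by do 2 case: ifP; lia.
have joins_p := pth_joins D.
have end1G j : end1 D j \in Gamma e by have [[]] := joins_p j.
have end2G j : end2 D j \in Gamma e by have [[]] := joins_p j.
have real_p j : realizes e (t j).+2 (path_inner (t j)) path_adj (psip j).
  exact: link_realizes (pth_copy D j) (joins_p j)
    (pth_notin _ _ (end1G j)) (pth_notin _ _ (end2G j)).
have set_c m : inner_set (g m + (h m).+1 - 1) (fun i : nat => i < g m + h m - 1)%N
    (psic m) = comps D (inl (inl m)).
  by apply: inner_set_extend; lia.
have set_t i : inner_set (k i + (l i).+1) (fun j : nat => j < k i + l i)%N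
    (psit i) = comps D (inl (inr i)).
  by apply: inner_set_extend; lia.
have set_p j : inner_set (t j).+2 (path_inner (t j)) (psip j) = comps D (inr j).
  by apply: inner_set_link; apply: pth_notin.
pose att (s : 'I_(cyclomatic e) + 'I_(nb_quasi_pendant e)) :=
  match s with inl m => vc m | inr i => vt i end.
pose u (s : 'I_(cyclomatic e) + 'I_(nb_quasi_pendant e)) :=
  match s with
  | inl m => psic m (g m + h m - 1).-1
  | inr i => psit i (k i + l i).-1
  end.
pose max_mult (s : 'I_(cyclomatic e) + 'I_(nb_quasi_pendant e)) :=
  if s is inl _ then 2%N else 1%N.
pose fst_nbr j := psip j 1%N.
pose lst_nbr j := psip j (t j).
have hub_edge v w : v \in Gamma e -> w \in Gamma e -> e v w -> exists j,
    [/\ v = end1 D j, w = end2 D j & w = fst_nbr j] \/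
    [/\ v = end2 D j, w = end1 D j & w = lst_nbr j].
  (* An edge inside Gamma is an empty internal path, along which the first and last neighbours are
     the opposite ends. *)
  move=> vG wG vw; have [j [[tj0 jE] _]] := pth_empty D vG wG vw.
  have wv : w != v by apply: contraTneq vw => ->; rewrite e_irr.
  have [fstE lstE] : fst_nbr j = end2 D j /\ lst_nbr j = end1 D j.
    exact: link_map_empty.
  exists j; rewrite fstE lstE.
  have : v \in [set end1 D j; end2 D j] by rewrite jE !inE eqxx.
  have : w \in [set end1 D j; end2 D j] by rewrite jE !inE eqxx orbT.
  rewrite !inE => /orP[] /eqP wE /orP[] /eqP vE; rewrite wE vE ?eqxx // in wv *.
    by right.
  by left.
(* Since [c(G) >= 1] there is a cyclic piece, and its hub serves as the root. *)
have [r r_in] : exists r, r \in Gamma e by exists (vc (Ordinal c_ge1)).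
have opt : (\dim (kerc (lapD e lam) setT)).+1 = (\sum_s max_mult s)%N <->
    (forall s, \dim (kerc (lapD e lam) (comps D (inl s))) = max_mult s) /\
    (forall j, \dim (kerc (lapD e lam) (comps D (inr j))) = 1%N).
  apply: (@network_multiplicity R T e lam e_sym (Gamma e) _ _ (comps D) att u
    (end1 D) (end2 D) fst_nbr lst_nbr max_mult).
  - exact: comps_cover.
  - exact: comps_disjoint.
  - exact: comps_separated.
  - by case=> [m|i]; [apply: vcG | apply: vtG].
  - by [].
  - by move=> j; have [[]] := joins_p j.
  - case=> [m|i] y v yB vG.
    + exact: pendant_edges (nc m) (cyc_copy D m) (vcP m) _ _ yB (cyc_notin _ _ vG).
    + exact: pendant_edges (nt i) (tre_copy D i) (vtP i) _ _ yB (tre_notin _ _ vG).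
  - by case=> [m|i]; apply: pendant_last_in; [apply: nc | apply: nt].
  - by move=> j y v yB vG; apply: (link_edges (pth_copy D j) (joins_p j)) => //; apply: pth_notin.
  - by move=> j; apply: (link_ends_in (pth_copy D j) (joins_p j)); apply: pth_notin.
  - exact: hub_edge.
  - case=> [m|i]; rewrite -?set_c -?set_t.
    + exact: dim_cycle_kernel (real_c m) (g_ge3 D m) (h_ge1 D m).
    + exact: dim_tree_kernel (real_t i) (l_ge1 D i) lam_neq1.
  - case=> [m|i]; rewrite -?set_c -?set_t => xu.
    + exact: dim_cycle_kernel_last (real_c m) (g_ge3 D m) (h_ge1 D m) xu.
    + rewrite ltnS leqn0 dimv_eq0 -subv0; apply/subvP => x xK; rewrite memv0.
      by apply/eqP/(tree_kernel_last (real_t i) (l_ge1 D i) lam_neq1 xK)/xu.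
  - by move=> j; rewrite -set_p; apply: dim_path_kernel.
  - by move=> j x; rewrite -set_p; apply: path_kernel_first.
  - by move=> j x; rewrite -set_p; apply: path_kernel_last.
  - by move=> v; rewrite inE => /and3P[].
  - exact: (proj2 e_conn).
  - exact: r_in.
  - by rewrite card_ord.
have sum_max : (\sum_s max_mult s = 2 * cyclomatic e + nb_quasi_pendant e)%N.
  by rewrite big_sumType /= !sum_nat_const !card_ord muln1 mulnC.
rewrite /lambda_optimal mult_laplacian //.
have -> : (\dim (kerc (lapD e lam) setT) = 2 * cyclomatic e + nb_quasi_pendant e - 1)%N
    <-> (\dim (kerc (lapD e lam) setT)).+1 = (\sum_s max_mult s)%N.
  (* As [c(G) >= 1], the natural number [2c + q] is positive and subtracting 1 does not truncate. *)
  by rewrite sum_max; split=> [->|<-]; rewrite ?subn1 // prednK // addn_gt0 muln_gt0 c_ge1.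
have cE m : mult (Qmx R (g m) (h m)) lam = \dim (kerc (lapD e lam) (comps D (inl (inl m)))).
  by rewrite (mult_Qmx lam e_sym (real_c m)) set_c.
have tE i : mult (Bmx R (k i) (l i)) lam = \dim (kerc (lapD e lam) (comps D (inl (inr i)))).
  by rewrite (mult_Bmx lam e_sym (real_t i)) set_t.
have pE j : mult (Umx R (t j)) lam = \dim (kerc (lapD e lam) (comps D (inr j))).
  by rewrite (mult_Umx lam e_sym (real_p j)) set_p.
rewrite opt; split=> [[dS dJ]|[dc [dt dp]]].
  split=> [m|]; first by rewrite cE dS.
  by split=> [i|j]; [rewrite tE dS | rewrite pE dJ].
split=> [[m|i]|j]; first by rewrite -cE dc.
  by rewrite -tE dt.
by rewrite -pE dp.
Qed.
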